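(* An NBW $\mathcal C$ is good-for-MDPs (GFM) if and only if $\mathcal C$ is qualitative good-for-MDPs (QGFM).
   Context: An NBW $\mathcal N=(\Sigma,Q,q_0,\delta,F)$ has transition function $\delta:Q\times\Sigma\to 2^Q$ and accepts an infinite word iff some run on it visits $F$ infinitely often. For a finite state-labelled MDP $\mathcal M=\langle S,\mathrm{Act},P,\Sigma,\ell\rangle$ ($P:S\times\mathrm{Act}\rightharpoonup\mathrm{Dist}(S)$, $\ell:S\to\Sigma$), $\mathrm{PSem}^{\mathcal M}_{\mathcal N}(s)=\sup_\mu\Pr^\mu_s\{r:\ell(r)\in\mathcal L(\mathcal N)\}$ over strategies $\mu$, where $\ell(r)$ is the label sequence of run $r$. The product $\mathcal M\times\mathcal N$ has states $S\times Q$; at $(s,q)$ the action $(m,q')$, for $m$ available at $s$ and $q'\in\delta(q,\ell(s))$, leads to $(s',q')$ with probability $P(s,m)(s')$. $\mathrm{PSyn}^{\mathcal M}_{\mathcal N}(s)$ is the supremum over product strategies of the probability, from $(s,q_0)$, of visiting $S\times F$ infinitely often. $\mathcal N$ is GFM if $\mathrm{PSyn}^{\mathcal M}_{\mathcal N}(s_0)=\mathrm{PSem}^{\mathcal M}_{\mathcal N}(s_0)$ for every finite MDP $\mathcal M$ and initial state $s_0$; $\mathcal N$ is QGFM if for every finite MDP $\mathcal M$ and initial state $s_0$ with $\mathrm{PSem}^{\mathcal M}_{\mathcal N}(s_0)=1$ it holds that $\mathrm{PSyn}^{\mathcal M}_{\mathcal N}(s_0)=1$. *)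

(* Defs.v *)
From HB Require Import structures.
From mathcomp Require Import all_boot all_order all_algebra.
From mathcomp Require Import all_classical all_reals all_analysis.

Set Implicit Arguments.
Unset Strict Implicit.
Unset Printing Implicit Defensive.

Import Order.TTheory GRing.Theory Num.Theory.
Local Open Scope classical_set_scope.
Local Open Scope ring_scope.

Record nbw (Sigma : finType) := NBW {
  nstate : finType;
  ninit  : nstate;
  ndelta : nstate -> Sigma -> {set nstate};
  nacc   : {set nstate} }.

Definition nbw_accepts (Sigma : finType) (N : nbw Sigma) (w : nat -> Sigma) : Prop :=
  exists rho : nat -> nstate N,
    rho 0%N = ninit N /\
    (forall i, rho i.+1 \in ndelta (rho i) (w i)) /\
    (forall n, exists2 i, (n <= i)%N & rho i \in nacc N).

Definition runs (X : finType) (x0 : X) : Type := nat -> X.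
HB.instance Definition _ (X : finType) (x0 : X) := Choice.on (runs x0).
HB.instance Definition _ (X : finType) (x0 : X) :=
  isPointed.Build (runs x0) (fun _ => x0).

Section MDPSemantics.
Variables (R : realType) (X B : finType) (x0 : X).
Variables (avail : X -> B -> bool) (P : X -> B -> X -> R).

(* general (history-dependent, randomized) strategies: given the history *)
(* s_0 m_0 ... s_{n-1} m_{n-1} and the current state s_n, a distribution *)
(* over the actions available in s_n                                      *)
Definition is_strategy (mu : seq (X * B) -> X -> B -> R) : Prop :=
  forall h x,
    (forall b, 0 <= mu h x b) /\ \sum_b mu h x b = 1 /\
    (forall b, 0 < mu h x b -> avail x b).

Fixpoint pref_wt (mu : seq (X * B) -> X -> B -> R)
    (h : seq (X * B)) (x : X) (rest : seq X) : R :=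
  match rest with
  | [::] => 1
  | y :: rest' =>
      \sum_b (mu h x b * P x b y * pref_wt mu (rcons h (x, b)) y rest')
  end.

Definition cyl_wt (mu : seq (X * B) -> X -> B -> R) (w : seq X) : R :=
  match w with
  | [::] => 1
  | x :: rest => (x == x0)%:R * pref_wt mu [::] x rest
  end.

Definition cyl (w : seq X) : set (runs x0) :=
  [set r | map r (iota 0 (size w)) = w].

Definition path_space := g_sigma_algebraType (range cyl).

Definition is_run_measure (mu : seq (X * B) -> X -> B -> R)
    (nu : probability path_space R) : Prop :=
  forall w, nu (cyl w : set path_space) = (cyl_wt mu w)%:E.

Definition max_prob (E : set (runs x0)) : \bar R :=
  ereal_sup [set p | exists mu (nu : probability path_space R),
    [/\ is_strategy mu, is_run_measure mu nu & p = nu (E : set path_space)]].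

End MDPSemantics.

Definition is_mdp (R : realType) (S A : finType)
    (avail : S -> A -> bool) (P : S -> A -> S -> R) : Prop :=
  (forall s, exists m, avail s m) /\
  (forall s m, avail s m ->
     (forall s', 0 <= P s m s') /\ \sum_s' P s m s' = 1).

Section Product.
Variables (R : realType) (Sigma : finType) (N : nbw Sigma).
Variables (S A : finType) (avail : S -> A -> bool) (P : S -> A -> S -> R)
  (lab : S -> Sigma) (s0 : S).

Definition PSem : \bar R :=
  max_prob (x0 := s0) avail P [set r | nbw_accepts N (lab \o r)].

(* Product M x N.  At (s,q) the actions are the (m,q') with m available *)
(* at s and q' in delta(q, l(s)); (m,q') leads to (s',q') w.p. P s m s'. *)
(* A product state with delta(q,l(s)) empty has no actions, i.e. the run *)
(* stops there (and is not accepting); this is encoded by a fresh       *)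
(* non-accepting absorbing sink None to which such states move.         *)
Definition prod_deadlock (s : S) (q : nstate N) : bool :=
  ndelta q (lab s) == finset.set0.

Definition prod_avail (x : option (S * nstate N)) (b : A * nstate N) : bool :=
  match x with
  | Some (s, q) =>
      if prod_deadlock s q then true
      else avail s b.1 && (b.2 \in ndelta q (lab s))
  | None => true
  end.

Definition prod_P (x : option (S * nstate N)) (b : A * nstate N)
    (y : option (S * nstate N)) : R :=
  match x, y with
  | Some (s, q), Some (s', q') =>
      if prod_deadlock s q then 0 else (q' == b.2)%:R * P s b.1 s'
  | Some (s, q), None => if prod_deadlock s q then 1 else 0
  | None, None => 1
  | None, Some _ => 0
  end.

Definition PSyn : \bar R :=
  max_prob (x0 := Some (s0, ninit N)) prod_avail prod_P
    [set r | forall n, exists2 i, (n <= i)%N &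
               exists s q, r i = Some (s, q) /\ q \in nacc N].

End Product.

Definition GFM (R : realType) (Sigma : finType) (N : nbw Sigma) : Prop :=
  forall (S A : finType) (avail : S -> A -> bool) (P : S -> A -> S -> R)
         (lab : S -> Sigma) (s0 : S),
    is_mdp avail P -> PSyn N avail P lab s0 = PSem N avail P lab s0.

Definition QGFM (R : realType) (Sigma : finType) (N : nbw Sigma) : Prop :=
  forall (S A : finType) (avail : S -> A -> bool) (P : S -> A -> S -> R)
         (lab : S -> Sigma) (s0 : S),
    is_mdp avail P -> PSem N avail P lab s0 = 1%E ->
    PSyn N avail P lab s0 = 1%E.

(* Main.v *)
(* The value of the semantic objective depends on the history only through    *)
(* the configuration (s, T), with s the current state and T the set of        *)
(* automaton states reachable on the labels read so far; a configuration is   *)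
(* winning when its value is 1. There are finitely many configurations, so    *)
(* the values of the others are bounded by some c < 1, and by a 0-1 law       *)
(* almost every accepted run meets a winning configuration. Hence PSem is the *)
(* limit of h_n ([hit] below), the optimal probability of meeting one within  *)
(* n steps. Conditioning an h_n-optimal strategy on that event (Doob's        *)
(* h-transform) and playing freely afterwards gives a finite MDP with         *)
(* PSem = 1, hence PSyn = 1 when the automaton is QGFM. A history is at most  *)
(* 1/h_n times likelier in the conditioned MDP than in the original one, so   *)
(* h_n <= PSyn, and PSem <= PSyn in the limit.                                *)

Require Import Defs.
From HB Require Import structures.
From mathcomp Require Import all_boot all_order all_algebra.
From mathcomp Require Import all_classical all_reals all_analysis.

Set Implicit Arguments.
Unset Strict Implicit.
Unset Printing Implicit Defensive.

Import Order.TTheory GRing.Theory Num.Theory.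
Local Open Scope classical_set_scope.
Local Open Scope ring_scope.

(** * Measures on run spaces *)

(** GFM gives QGFM by instantiation; the converse is the conditioning argument outlined above. Its
    measure theory goes through cylinder weights: [cylinder_extension] turns additive weights into a
    measure, and [le_measure_cyl] lifts domination from cylinders to all events. Strategies are
    therefore handled as masses of histories: [strategy_flow] reads flows off a strategy,
    [le_max_prob] recovers a strategy from them. Combined, they give [simulation], which compares
    two MDPs along a map of states and a potential, and yields [PSyn_le_PSem],
    [value_le_conditioned] and the likelihood bound [PSyn_conditioned_le].

    On the semantic side, [never_winning_null] is the 0-1 law, [accepts_le_sup_hit] bounds PSem by
    any bound on all the [hit k], and [conditioned_value] shows that the conditioned MDP has value
    1. Acceptance quantifies over automaton runs, so its measurability needs the Ramsey-style
    description [accepts_fromE]. *)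

Section PathSpace.
Variables (X : finType) (x0 : X).
Local Notation PS := (path_space x0).

Lemma measurable_cyl w : measurable (cyl w : set PS).
Proof. by apply: sub_sigma_algebra; exists w. Qed.

Lemma cylP (r : runs x0) w : cyl w r <-> mkseq r (size w) = w.
Proof. by []. Qed.

Lemma cyl_mkseq (r : runs x0) n : cyl (mkseq r n) r.
Proof. by rewrite cylP size_mkseq. Qed.

Lemma cyl_rcons (r : runs x0) u x :
  cyl (rcons u x) r <-> cyl u r /\ r (size u) = x.
Proof.
rewrite !cylP size_rcons mkseqS; split=> [/eqP|[-> ->]//].
by rewrite eqseq_rcons => /andP[/eqP-> /eqP->].
Qed.

Lemma cyl_nil : cyl [::] = [set: runs x0].
Proof. by apply/seteqP; split. Qed.

Lemma bigcup_cyl_rcons u : \bigcup_x cyl (rcons u x) = cyl u :> set (runs x0).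
Proof.
apply/seteqP; split=> [r [x _]|r ur]; first by case/cyl_rcons.
by exists (r (size u)) => //; apply/cyl_rcons.
Qed.

Lemma cyl_cat (r : runs x0) u v : cyl (u ++ v) r <->
  cyl u r /\ cyl v ((fun n => r (size u + n)%N) : runs x0).
Proof.
elim/last_ind: v => [|v y IH]; first by rewrite cats0 cyl_nil; split=> [|[]].
rewrite -rcons_cat !cyl_rcons IH size_cat; split=> [[[? ?] ?]//|[? [? ?]]//].
Qed.

(** Two cylinders are nested or disjoint; with the empty set added they form the pi-system on which
    measures are compared. *)
Lemma cyl_setI_closed :
  setI_closed ([set set0] `|` range (@cyl X x0) : set (set PS)).
Proof.
move=> _ B [->|[u _ <-]]; first by left; rewrite set0I.
move=> [->|[v _ <-]]; first by left; rewrite setI0.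
wlog suv : u v / (size u <= size v)%N.
  by move=> W; case: (leqP (size u) (size v)) => [|/ltnW]/W //; rewrite setIC.
have [uv|uv] := eqVneq (take (size u) v) u.
  right; exists v => //; rewrite setIidr// => r.
  by rewrite -(cat_take_drop (size u) v) uv => /cyl_cat[].
left; apply/seteqP; split=> // r [/cylP ur].
rewrite -(cat_take_drop (size u) v) => /cyl_cat[/cylP tr _].
by case/eqP: uv; rewrite -tr size_takel.
Qed.

Lemma measurable_prefix n (Phi : set (seq X)) :
  measurable ([set r | Phi (mkseq r n)] : set PS).
Proof.
have -> : [set r | Phi (mkseq r n)] = \bigcup_w
    (if `[< size w = n /\ Phi w >] then cyl w else set0) :> set PS; last first.
  apply: countable_bigcupT_measurable => [|w]; first exact: countableP.
  by case: ifP => _ //; exact: measurable_cyl.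
apply/seteqP; split=> r /=; last first.
  by move=> [w _]; case: ifP => // /asboolP[<- Pw] /cylP ->.
move=> Pr; exists (mkseq r n) => //.
by rewrite asboolT ?size_mkseq//; exact: cyl_mkseq.
Qed.

Lemma measurable_finitary n (E : set (nat -> X)) :
  (forall r r', (forall i, (i < n)%N -> r i = r' i) -> E r -> E r') ->
  measurable (E : set PS).
Proof.
move=> En; rewrite (_ : (E : set PS) = [set r | exists2 r', E r' &
   mkseq r' n = mkseq r n]).
  exact: (measurable_prefix n [set w | exists2 r', E r' & mkseq r' n = w]).
apply/seteqP; split=> r /= => [Er|[r' Er' e]]; first by exists r.
apply: En Er' => i ni.
by have := congr1 (fun s => nth x0 s i) e; rewrite !nth_mkseq.
Qed.

Lemma measurable_at n (D : set X) : measurable ([set r | D (r n)] : set PS).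
Proof. by apply: (@measurable_finitary n.+1) => r r' e; rewrite /= e. Qed.

Lemma measurable_path_fun d (T : measurableType d) (f : T -> PS) :
  (forall n x, measurable [set t | f t n = x]) -> measurable_fun setT f.
Proof.
move=> fm; apply: (@measurability _ _ T PS setT f (range (@cyl X x0))) => //.
move=> _ [_ [w _ <-] <-].
rewrite setTI; elim/last_ind: w => [|w x IH].
  by rewrite cyl_nil preimage_setT.
rewrite (_ : _ @^-1` _ = (f @^-1` cyl w) `&` [set t | f t (size w) = x]).
  exact: measurableI.
by apply/seteqP; split=> t /= /cyl_rcons.
Qed.

End PathSpace.

Arguments cylP {X x0} r w.
Arguments measurable_cyl {X x0} w.
Arguments measurable_prefix {X x0} n Phi.
Arguments measurable_at {X x0} n D.

Section Pushforwards.
Variables (X Y : finType) (x0 : X) (y0 : Y).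

Definition path_map (f : X -> Y) (r : path_space x0) : path_space y0 := f \o r.

Lemma measurable_path_map f : measurable_fun setT (path_map f).
Proof.
apply: measurable_path_fun => n y.
by apply: (@measurable_finitary _ _ n.+1) => r r' e; rewrite /path_map /= e.
Qed.

End Pushforwards.

Arguments measurable_path_map {X Y} x0 y0 f.

Section Shifts.
Variables (X : finType) (x0 x1 : X).

Definition path_shift k (r : path_space x0) : path_space x1 :=
  fun n => r (k + n)%N.

Lemma measurable_path_shift k : measurable_fun setT (path_shift k).
Proof.
apply: measurable_path_fun => n y.
apply: (@measurable_finitary _ _ (k + n).+1) => r r' e.
by rewrite /path_shift /= e.
Qed.

Definition path_cons (r : path_space x0) : path_space x1 :=
  fun n => if n is n'.+1 then r n' else x1.

Lemma measurable_path_cons : measurable_fun setT path_cons.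
Proof.
apply: measurable_path_fun => -[|n] y.
  by apply: (@measurable_finitary _ _ 0%N).
by apply: (@measurable_finitary _ _ n.+1) => r r' e; rewrite /path_cons /= e.
Qed.

End Shifts.

Arguments measurable_path_shift {X} x0 x1 k.
Arguments measurable_path_cons {X} x0 x1.

(** * Measures from cylinder weights *)

Section Quantile.
Variables (R : realType) (X : finType) (f : X -> R) (d : X).
Hypothesis f_ge0 : forall x, 0 <= f x.

(** Inverse distribution function of the weights [f] along the list; [d] is the value past the total
    mass. *)
Fixpoint quantile (s : seq X) (t : R) : X :=
  if s is y :: s' then if t < f y then y else quantile s' (t - f y) else d.

Lemma quantile_mem s t : t < \sum_(z <- s) f z -> 0 <= t -> quantile s t \in s.
Proof.
elim: s t => [|y s IH] t /=.
  by rewrite big_nil => /lt_le_trans H /H; rewrite ltxx.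
rewrite big_cons inE => ts t0; case: ltP => [|yt]; first by rewrite eqxx.
by rewrite IH ?orbT// ?subr_ge0// ltrBlDl.
Qed.

Lemma quantile_eq s t y : uniq s -> y \in s -> 0 <= t < \sum_(z <- s) f z ->
  (quantile s t == y) = (\sum_(z <- take (index y s) s) f z <= t <
                         \sum_(z <- take (index y s) s) f z + f y).
Proof.
elim: s t => [//|z s IH] t /= /andP[zs us]; rewrite inE => ys /andP[t0].
rewrite big_cons => ts; have [<-|zy] := eqVneq z y.
  rewrite big_nil add0r t0 /=; case: ltP => [|zt]; first by rewrite eqxx.
  apply: contraNF zs => /eqP e; rewrite -[z in z \in s]e.
  by rewrite quantile_mem// ?subr_ge0// ltrBlDl.
move: ys; rewrite eq_sym (negbTE zy) /= => ys; rewrite big_cons.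
case: ltP => [tz|zt].
  rewrite (negbTE zy); symmetry; apply/negbTE; rewrite negb_and -!ltNge.
  by rewrite (lt_le_trans tz)// lerDl sumr_ge0.
rewrite IH//; last by rewrite subr_ge0 zt ltrBlDl.
by rewrite lerBrDl ltrBlDl addrA.
Qed.

End Quantile.

(** Restriction to [D] followed by pushforward, packaged existentially to keep measurability proofs
    out of later terms. *)
Lemma measure_image d1 d2 (T1 : measurableType d1) (T2 : measurableType d2)
    (R : realType) (mu : {measure set T1 -> \bar R}) (D : set T1)
    (f : T1 -> T2) : measurable D -> measurable_fun setT f ->
  exists nu : {measure set T2 -> \bar R},
    forall A, nu A = mu (D `&` f @^-1` A).
Proof.
move=> mD mf; unshelve eexists (pushforward (mrestr mu mD) f); first exact: mf.
by move=> A; rewrite /= /pushforward /mrestr setIC.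
Qed.

(* The run space is the image of an interval: a point of [0, wt [::][ is read *)
(* as the run whose prefixes index the nested subintervals that contain it.   *)
(* The prefixes handled by [rlo] and [rpre] are reversed words.               *)
Section Extension.
Variables (R : realType) (X : finType) (x0 : X) (wt : seq X -> R).
Hypothesis wt_ge0 : forall w, 0 <= wt w.
Hypothesis wt_sum : forall w, wt w = \sum_x wt (rcons w x).

Let step v z : R := wt (rcons (rev v) z).

Let lower v y : R := \sum_(z <- take (index y (enum X)) (enum X)) step v z.

Fixpoint rlo (v : seq X) : R := if v is y :: v' then rlo v' + lower v' y else 0.

Fixpoint rpre (t : R) n : seq X :=
  if n is n'.+1 then
    let v := rpre t n' in quantile (step v) x0 (enum X) (t - rlo v) :: v
  else [::].

Let step_sum v : \sum_(z <- enum X) step v z = wt (rev v).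
Proof. by rewrite wt_sum big_enum. Qed.

Let step_ge0 v z : 0 <= step v z. Proof. exact: wt_ge0. Qed.

Let lower_ge0 v y : 0 <= lower v y. Proof. by rewrite sumr_ge0. Qed.

Let lower_le v y : lower v y + step v y <= wt (rev v).
Proof.
have yX : y \in enum X by rewrite mem_enum.
rewrite -step_sum -[in leRHS](cat_take_drop (index y (enum X)) (enum X)).
rewrite big_cat lerD2l (drop_nth y) ?index_mem// nth_index// big_cons lerDl.
by rewrite sumr_ge0.
Qed.

Lemma rlo_bounds v : 0 <= rlo v /\ rlo v + wt (rev v) <= wt [::].
Proof.
elim: v => [|y v [IH1 IH2]] /=; first by rewrite add0r.
split; first by rewrite addr_ge0.
apply: le_trans IH2; rewrite -addrA lerD2l rev_cons; exact: lower_le.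
Qed.

(** One-letter extensions occupy consecutive subintervals of the parent interval, so inside it the
    quantile picks the letter whose subinterval contains [t]; a point outside the parent is outside
    the child. *)
Lemma rpre_eq t v : 0 <= t < wt [::] ->
  (rpre t (size v) == v) = (rlo v <= t < rlo v + wt (rev v)).
Proof.
move=> tM; elim: v => [|y v IH] /=; first by rewrite add0r tM.
rewrite eqseq_cons; case: (eqVneq (rpre t (size v)) v) => [e|ne].
  move: IH; rewrite e eqxx andbT => /esym/andP[lt tl].
  rewrite quantile_eq ?enum_uniq ?mem_enum//; last first.
    by rewrite subr_ge0 lt step_sum ltrBlDl.
  by rewrite rev_cons lerBrDl ltrBlDl addrA.
rewrite andbF; symmetry; apply: contraNF ne => /andP[t1 t2].
rewrite IH (le_trans _ t1) ?lerDl//= (lt_le_trans t2)//.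
by rewrite -addrA lerD2l rev_cons; exact: lower_le.
Qed.

Let I0 : set (measurableTypeR R) := `[0, wt [::][%classic.

(** The constant run outside [I0] only makes the function total: Lebesgue measure is restricted to
    [I0] before it is pushed forward. *)
Definition path_of (t : measurableTypeR R) : path_space x0 :=
  fun n => if t \in I0 then head x0 (rpre t n.+1) else x0.

Lemma path_of_cyl w t : I0 t ->
  cyl w (path_of t : runs x0) <-> rlo (rev w) <= t < rlo (rev w) + wt w.
Proof.
move=> It.
have pre n : mkseq (path_of t) n = rev (rpre t n).
  elim: n => // n IH; rewrite mkseqS IH /path_of mem_set//= rev_cons.
  by [].
have tI : 0 <= t < wt [::] by move: It; rewrite /I0 /= in_itv.
have := rpre_eq (rev w) tI; rewrite revK size_rev => <-.
split=> [/cylP|/eqP e]; last by apply/cylP; rewrite pre e revK.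
by rewrite pre => {2}<-; rewrite revK.
Qed.

Lemma preimage_path_of w : I0 `&` path_of @^-1` (cyl w) =
  `[rlo (rev w), rlo (rev w) + wt w[%classic.
Proof.
apply/seteqP; split=> t /=; first by rewrite in_itv /= => -[It /(path_of_cyl _ It)].
rewrite in_itv /= => tw; suff It : I0 t by split=> //; apply/path_of_cyl.
have [l0 l1] := rlo_bounds (rev w); rewrite revK in l1.
case/andP: tw => t1 t2; rewrite /I0 /= in_itv /=.
by rewrite (le_trans l0 t1) (lt_le_trans t2 l1).
Qed.

Lemma measurable_path_of : measurable_fun setT path_of.
Proof.
have mI0 : measurable I0 by exact: measurable_itv.
apply: (@measurability _ _ _ (path_space x0) setT _ (range (@cyl X x0))) => //.
move=> _ [_ [w _ <-] <-]; rewrite setTI.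
rewrite -(setUIDK (path_of @^-1` cyl w) I0) setIC preimage_path_of.
apply: (@measurableU _ (measurableTypeR R)); first exact: measurable_itv.
(* Outside [I0] the function is constant, so there the preimage of a cylinder is everything or
   nothing. *)
have [c|c] := pselect (@cyl X x0 w (fun=> x0)).
  rewrite (_ : _ `\` _ = ~` I0); first exact: measurableC.
  apply/seteqP; split=> t /= => [[]//|nt]; split=> //.
  by rewrite /preimage /= /path_of memNset.
rewrite (_ : _ `\` _ = set0)//.
apply/seteqP; split=> t //= [+ nt]; rewrite /preimage /= /path_of => H; apply: c.
by move: H; rewrite memNset.
Qed.

(** Kolmogorov extension as an image of Lebesgue measure: within [I0], the preimage of a cylinder is
    an interval of length [wt w]. *)
Lemma cylinder_extension : exists mu : {measure set (path_space x0) -> \bar R},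
  forall w, mu (cyl w) = (wt w)%:E.
Proof.
have mI0 : measurable I0 by exact: measurable_itv.
have [mu muE] := measure_image (@lebesgue_measure R) mI0 measurable_path_of.
exists mu => w; rewrite muE preimage_path_of.
apply: etrans (lebesgue_measure_itv _) _; rewrite /= lte_fin; case: ltP => [_|].
  by rewrite -EFinD addrAC subrr add0r.
by rewrite gerDl => w0; congr EFin; apply/eqP; rewrite eq_le w0 wt_ge0.
Qed.

End Extension.

Section CylinderMeasure.
Variables (R : realType) (X : finType) (x0 : X).
Local Notation PS := (path_space x0).

Lemma measure_cyl_split (mu : {measure set PS -> \bar R}) (E : set PS) u :
  measurable E ->
  mu (cyl u `&` E) = (\sum_x mu (cyl (rcons u x) `&` E))%E.
Proof.
move=> mE; rewrite -bigcup_cyl_rcons setI_bigcupl measure_fin_bigcup //.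
- have -> : [set: X] = [set` enum X].
    by apply/seteqP; split=> x //= _; rewrite mem_enum.
  by rewrite -[RHS]big_enum -fsbig_seq ?enum_uniq.
- exact: finite_finset.
- move=> x y _ _ [r [[/cyl_rcons[_ <-] _] [/cyl_rcons[_ <-] _]]].
  by [].
- by move=> x _; apply: measurableI => //; exact: measurable_cyl.
Qed.

Lemma measure_cyl_sum (mu : {measure set PS -> \bar R}) u :
  mu (cyl u) = (\sum_x mu (cyl (rcons u x)))%E.
Proof.
have := @measure_cyl_split mu setT u measurableT; rewrite setIT => ->.
by apply: eq_bigr => x _; rewrite setIT.
Qed.

(** The differences of the cylinder masses are nonnegative and additive, hence extend to a measure
    [mu3]; uniqueness on the pi-system gives [mu2] as the sum of [mu1] and [mu3]. *)
Lemma le_measure_cyl (mu1 mu2 : {measure set PS -> \bar R}) (E : set PS) :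
  (forall u x, mu1 (cyl (rcons u x)) <= mu2 (cyl (rcons u x)) < +oo)%E ->
  measurable E -> (mu1 E <= mu2 E)%E.
Proof.
move=> mu12 mE.
have le12 w : (mu1 (cyl w) <= mu2 (cyl w))%E.
  case/lastP: w => [|w x]; last by case/andP: (mu12 w x).
  by rewrite !measure_cyl_sum; apply: lee_sum => x _; case/andP: (mu12 [::] x).
have fin2 w : mu2 (cyl w) \is a fin_num.
  rewrite ge0_fin_numE//; case/lastP: w => [|w x]; last by case/andP: (mu12 w x).
  rewrite measure_cyl_sum; apply/lte_sum_pinfty => x _.
  by case/andP: (mu12 [::] x).
have fin1 w : mu1 (cyl w) \is a fin_num.
  by rewrite ge0_fin_numE// (le_lt_trans (le12 w))// -ge0_fin_numE.
have [|w|mu3 mu3E] := @cylinder_extension R X x0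
    (fun w => fine (mu2 (cyl w)) - fine (mu1 (cyl w))).
- by move=> w; rewrite subr_ge0 fine_le.
- by rewrite sumrB !sum_fine// -!measure_cyl_sum.
suff -> : mu2 E = measure_add mu1 mu3 E by rewrite measure_addE leeDl.
apply: (@measure_unique _ _ PS ([set set0] `|` range (@cyl X x0)) (fun=> setT)).
- apply/seteqP; split; first by apply: sub_sigma_algebra2 => A; right.
  apply: smallest_sub; first exact: sigma_algebra_measurable.
  by move=> A [->//|[w _ <-]]; exact: measurable_cyl.
- exact: cyl_setI_closed.
- by move=> _; right; exists [::] => //; rewrite cyl_nil.
- by rewrite bigcup_const//; exists 0%N.
- move=> _ [->|[w _ <-]]; first by rewrite !measure0.
  apply: etrans (esym (measure_addE mu1 mu3 _)); rewrite mu3E.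
  by rewrite -[in RHS](fineK (fin1 w)) -EFinD addrC subrK fineK.
- by move=> _; rewrite -cyl_nil -ge0_fin_numE.
- by [].
Qed.

End CylinderMeasure.

(** * Strategies and run measures *)

Section MDPMeasures.
Variables (R : realType) (X B : finType).
Variables (avail : X -> B -> bool) (P : X -> B -> X -> R).
Hypothesis M : is_mdp avail P.

(* [e b] is the joint mass of the history [rcons u x] and of the choice of    *)
(* [b] after it: a measure comes from a strategy iff it has flows everywhere. *)
Definition is_flow (x0 : X) (nu : set (path_space x0) -> \bar R) u x
    (e : B -> R) : Prop :=
  [/\ forall b, 0 <= e b, forall b, 0 < e b -> avail x b,
      nu (cyl (rcons u x)) = (\sum_b e b)%:E &
      forall y, nu (cyl (rcons (rcons u x) y)) = (\sum_b e b * P x b y)%:E].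

Lemma mulr_trans_ge0 (e : B -> R) x b y :
  0 <= e b -> (0 < e b -> avail x b) -> 0 <= e b * P x b y.
Proof.
rewrite le_eqVlt => /orP[/eqP<- _|e0 /(_ e0) xb]; first by rewrite mul0r.
by rewrite mulr_ge0 ?(ltW e0)//; have [] := M.2 _ _ xb.
Qed.

Lemma trans_sum (e : B -> R) x : (forall b, 0 <= e b) ->
  (forall b, 0 < e b -> avail x b) ->
  \sum_y \sum_b e b * P x b y = \sum_b e b.
Proof.
move=> e0 ea; rewrite exchange_big; apply: eq_bigr => b _; rewrite -mulr_sumr.
have [->|eb] := eqVneq (e b) 0; first by rewrite mul0r.
by have [] := M.2 x b; rewrite ?ea ?lt_def ?eb ?e0// => _ ->; rewrite mulr1.
Qed.

Section PrefixExpectation.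
Variable mu : seq (X * B) -> X -> B -> R.

(** [pref_wt] with a terminal payoff [k]. Runs do not record actions, so the choice made at the end
    of a state word has to be averaged over the action histories compatible with it. *)
Fixpoint pref_exp h x rest (k : seq (X * B) -> X -> R) : R :=
  if rest is y :: rest' then
    \sum_b mu h x b * P x b y * pref_exp (rcons h (x, b)) y rest' k
  else k h x.

Lemma pref_exp_rcons h x rest y k : pref_exp h x (rcons rest y) k =
  pref_exp h x rest
    (fun h z => \sum_b mu h z b * P z b y * k (rcons h (z, b)) y).
Proof.
by elim: rest h x => [//|z rest IH] h x /=; apply: eq_bigr => b _; rewrite IH.
Qed.

Lemma pref_wtE h x rest :
  pref_wt P mu h x rest = pref_exp h x rest (fun _ _ => 1).
Proof.
by elim: rest h x => [//|z rest IH] h x /=; apply: eq_bigr => b _; rewrite IH.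
Qed.

Lemma pref_exp_sum h x rest (k : B -> seq (X * B) -> X -> R) (c : B -> X -> R) :
  pref_exp h x rest (fun h z => \sum_b k b h z * c b z) =
  \sum_b pref_exp h x rest (k b) * c b (last x rest).
Proof.
elim: rest h x => [//|z rest IH] h x /=.
under eq_bigr do rewrite IH mulr_sumr.
rewrite exchange_big; apply: eq_bigr => b _; rewrite mulr_suml.
by apply: eq_bigr => b' _; rewrite mulrA.
Qed.

Lemma eq_pref_exp h x rest k k' : (forall h z, k h z = k' h z) ->
  pref_exp h x rest k = pref_exp h x rest k'.
Proof.
move=> kk.
by elim: rest h x => [//|z rest IH] h x /=; apply: eq_bigr => b _; rewrite IH.
Qed.

Lemma pref_exp_eq0 h x rest k :
  (forall h, k h (last x rest) = 0) -> pref_exp h x rest k = 0.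
Proof.
elim: rest h x => [|z rest IH] h x /= k0; first exact: k0.
rewrite big1// => b _.
by rewrite IH ?mulr0.
Qed.

Hypothesis smu : is_strategy avail mu.

Lemma pref_exp_ge0 h x rest k :
  (forall h x, 0 <= k h x) -> 0 <= pref_exp h x rest k.
Proof.
move=> k0; elim: rest h x => [//|z rest IH] h x /=; apply: sumr_ge0 => b _.
have [mu0 [_ mua]] := smu h x.
by apply: mulr_ge0 => //; apply: (@mulr_trans_ge0 (mu h x)) => // /mua.
Qed.

(** The flow at [b] is the probability that [mu] chooses [b], averaged over the action histories
    along [rcons u x]. *)
Lemma strategy_flow x0 (nu : probability (path_space x0) R) :
  is_run_measure P mu nu -> forall u x, exists e, is_flow nu u x e.
Proof.
move=> numu u x.
have [x1 [rest [E lastE]]] : exists x1 rest,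
    rcons u x = x1 :: rest /\ last x1 rest = x.
  case: u => [|x1 u]; first by exists x, [::].
  by exists x1, (rcons u x); rewrite last_rcons.
have wtE : nu (cyl (rcons u x)) =
    ((x1 == x0)%:R * pref_exp [::] x1 rest (fun _ _ => 1))%:E.
  by rewrite numu E /cyl_wt pref_wtE.
exists (fun b => (x1 == x0)%:R * pref_exp [::] x1 rest (fun h z => mu h z b)).
have e0 b : 0 <= (x1 == x0)%:R * pref_exp [::] x1 rest (fun h z => mu h z b).
  by rewrite mulr_ge0// pref_exp_ge0// => h z; have [] := smu h z.
split=> [//|b eb||y].
- apply/negP => /negP nxb; move: eb; rewrite pref_exp_eq0 ?mulr0 ?ltxx// => h.
  rewrite lastE; have [mu0 [_ mua]] := smu h x.
  apply/eqP; apply: contraNT nxb => mub; apply: mua.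
  by rewrite lt_def mub mu0.
- rewrite wtE -mulr_sumr; congr (_ * _)%:E.
  have := pref_exp_sum [::] x1 rest (fun b h z => mu h z b) (fun _ _ => 1).
  under [RHS]eq_bigr do rewrite mulr1; move=> <-.
  apply: eq_pref_exp => h z; under eq_bigr do rewrite mulr1.
  by have [_ [-> _]] := smu h z.
- rewrite numu E /= pref_wtE pref_exp_rcons; congr EFin.
  under [RHS]eq_bigr do rewrite -mulrA; rewrite -mulr_sumr; congr (_ * _).
  have := pref_exp_sum [::] x1 rest (fun b h z => mu h z b) (fun b z => P z b y).
  rewrite lastE => <-; apply: eq_pref_exp => h z.
  by apply: eq_bigr => b _; rewrite mulr1.
Qed.

End PrefixExpectation.

Section StateStrategies.
Variable sigma : seq X -> X -> B -> R.
Let mu (h : seq (X * B)) x b := sigma (unzip1 h) x b.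

(** When choices depend on past states only, the last factor is common to all action histories and
    comes out of the sum. *)
Lemma pref_wt_rcons h x rest y : pref_wt P mu h x (rcons rest y) =
  pref_wt P mu h x rest *
  \sum_b sigma (unzip1 h ++ belast x rest) (last x rest) b *
         P (last x rest) b y.
Proof.
elim: rest h x => [|z rest IH] h x /=.
  by rewrite mul1r cats0; apply: eq_bigr => b _; rewrite mulr1.
rewrite mulr_suml; apply: eq_bigr => b _; rewrite IH mulrA; congr (_ * _).
by rewrite /unzip1 map_rcons cat_rcons.
Qed.

Lemma cyl_wt_rcons x0 u x y : cyl_wt x0 P mu (rcons (rcons u x) y) =
  cyl_wt x0 P mu (rcons u x) * \sum_b sigma u x b * P x b y.
Proof.
case: u => [|x1 u] /=.
  by rewrite -mulrA mul1r; congr (_ * _); apply: eq_bigr => b _; rewrite mulr1.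
by rewrite pref_wt_rcons mulrA last_rcons belast_rcons.
Qed.

Hypothesis ssigma : forall u x, (forall b, 0 <= sigma u x b) /\
  \sum_b sigma u x b = 1 /\ (forall b, 0 < sigma u x b -> avail x b).

Lemma state_strategy_measure x0 : exists2 nu : probability (path_space x0) R,
  is_run_measure P mu nu & is_strategy avail mu.
Proof.
have smu : is_strategy avail mu by move=> h x; exact: ssigma.
have [w|w|nu nuE] := @cylinder_extension R X x0 (cyl_wt x0 P mu).
- by case: w => [//|x w] /=; rewrite mulr_ge0// pref_wtE pref_exp_ge0.
- case/lastP: w => [|u x].
    rewrite (bigD1 x0)//= eqxx mulr1 big1 ?addr0// => x /negbTE ->.
    by rewrite mul0r.
  under eq_bigr do rewrite cyl_wt_rcons.
  have [s0 [s1 sa]] := ssigma u x.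
  by rewrite -mulr_sumr trans_sum// s1 mulr1.
have nu1 : nu setT = 1%E by rewrite -cyl_nil nuE.
(* The mass is already 1; normalizing serves to obtain a term of the type of probabilities. *)
exists (mnormalize nu (dirac ((fun=> x0) : path_space x0))) => // w.
by rewrite /= /mnormalize nu1 /= onee_eq0 /= invr1 mule1 nuE.
Qed.

End StateStrategies.

(* To bound [max_prob] from below it suffices to exhibit a super-solution [m]  *)
(* of the flow equations that dominates [mu] on cylinders.                     *)
Lemma le_max_prob x0 (k : R) (m : seq X -> R) (e : seq X -> X -> B -> R)
    (mu : {measure set (path_space x0) -> \bar R}) (E : set (path_space x0)) :
  0 <= k ->
  (forall x, m [:: x] <= k * (x == x0)%:R) ->
  (forall u x b, 0 <= e u x b) ->
  (forall u x b, 0 < e u x b -> avail x b) ->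
  (forall u x, \sum_b e u x b <= m (rcons u x)) ->
  (forall u x y, m (rcons (rcons u x) y) <= \sum_b e u x b * P x b y) ->
  (forall u x, (mu (cyl (rcons u x)) <= (m (rcons u x))%:E)%E) ->
  measurable E -> (mu E <= k%:E * max_prob (x0 := x0) avail P E)%E.
Proof.
move=> k0 m1 e0 ea em mS mum mE.
have m0 u x : 0 <= m (rcons u x) by apply: le_trans (em u x); exact: sumr_ge0.
have [dflt dP] := choice M.1.
(* The mass by which the flow falls short of [m] goes to a default available action, so [f u x] sums
   exactly to [m (rcons u x)] and [sigma] is its normalization. *)
pose f u x b := e u x b + (m (rcons u x) - \sum_c e u x c) * (b == dflt x)%:R.
pose sigma u x b := if 0 < m (rcons u x) then f u x b / m (rcons u x)
                    else (b == dflt x)%:R.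
have ef u x b : e u x b <= f u x b by rewrite lerDl mulr_ge0// subr_ge0.
have dsum x : \sum_b (b == dflt x)%:R = 1 :> R.
  by rewrite (bigD1 (dflt x))//= eqxx big1 ?addr0// => b /negbTE ->.
have fa u x b : 0 < f u x b -> avail x b.
  have [->|nd] := eqVneq b (dflt x); first by [].
  by rewrite /f (negbTE nd) mulr0 addr0; exact: ea.
have ssigma u x : (forall b, 0 <= sigma u x b) /\
    \sum_b sigma u x b = 1 /\ (forall b, 0 < sigma u x b -> avail x b).
  rewrite /sigma; case: ltP => [mp|_].
    split=> [b|]; first by rewrite divr_ge0// (le_trans (e0 u x b) (ef u x b)).
    split=> [|b]; last by rewrite pmulr_lgt0 ?invr_gt0//; exact: fa.
    rewrite -mulr_suml big_split /= -mulr_sumr dsum mulr1 addrC subrK.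
    by rewrite divff// gt_eqF.
  split=> [b|]; first by [].
  split=> [|b]; first exact: dsum.
  by case: eqVneq => [->|]; rewrite ?ltxx.
have [nu nuE smu] := state_strategy_measure ssigma x0.
pose wt := cyl_wt x0 P (fun h x b => sigma (unzip1 h) x b).
have {}nuE w : nu (cyl w) = (wt w)%:E by exact: nuE.
(* Where [m] is positive, [m] times [sigma] is [f], which dominates [e]; where [m] vanishes, so does
   [e]. Either way one step preserves the bound. *)
have mwt u x : m (rcons u x) <= k * wt (rcons u x).
  elim/last_ind: u x => [|u z IH] x; first by rewrite /wt /= mulr1 m1.
  apply: le_trans (mS u z x) _; rewrite /wt cyl_wt_rcons mulrA.
  have [s0 [_ sa]] := ssigma u z.
  apply: (@le_trans _ _ (m (rcons u z) * \sum_b sigma u z b * P z b x)); last first.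
    rewrite ler_wpM2r ?IH// sumr_ge0// => b _.
    by apply: (@mulr_trans_ge0 (sigma u z)) => // /sa.
  rewrite mulr_sumr; apply: ler_sum => b _; rewrite mulrA.
  have [mp|mle] := ltP 0 (m (rcons u z)).
    rewrite /sigma mp mulrCA divff ?gt_eqF// mulr1.
    have [fb|fb] := ltP 0 (f u z b).
      by rewrite ler_wpM2r//; have [] := M.2 _ _ (fa _ _ _ fb).
    have -> : f u z b = 0.
      by apply/eqP; rewrite eq_le fb (le_trans (e0 u z b) (ef u z b)).
    have -> : e u z b = 0.
      by apply/eqP; rewrite eq_le (le_trans (ef u z b) fb) e0.
    by [].
  have mz : m (rcons u z) = 0 by apply/eqP; rewrite eq_le mle m0.
  have -> : e u z b = 0.
    apply/eqP; rewrite eq_le e0 andbT -mz; apply: le_trans (em u z).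
    by rewrite (bigD1 b)//= lerDl sumr_ge0.
  by rewrite mz !mul0r.
apply: (@le_trans _ _ (k%:E * nu E)%E); last first.
  apply: lee_wpmul2l; first by rewrite lee_fin.
  by apply: ereal_sup_ubound; exists (fun h x b => sigma (unzip1 h) x b), nu.
have -> : (k%:E * nu E)%E = mscale (NngNum k0) nu E by [].
apply: le_measure_cyl => // u x.
rewrite /= /mscale /= nuE -EFinM ltry andbT.
by apply: le_trans (mum u x) _; rewrite lee_fin.
Qed.

Lemma max_prob_ge0 x0 (E : set (path_space x0)) :
  measurable E -> (0 <= max_prob (x0 := x0) avail P E)%E.
Proof.
move=> mE; have := @le_max_prob x0 1 (fun=> 0) (fun _ _ _ => 0) mzero E.
rewrite mul1e; apply=> //.
all: move=> *; rewrite ?mul1r ?big1 ?ler0n // => *; rewrite ?mul0r //.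
by case/negP: (ltxx (0 : R)).
Qed.

End MDPMeasures.

Lemma max_prob_le1 (R : realType) (X B : finType) (avail : X -> B -> bool)
    (P : X -> B -> X -> R) x0 (E : set (path_space x0)) :
  measurable E -> (max_prob (x0 := x0) avail P E <= 1)%E.
Proof.
move=> mE; apply: ge_ereal_sup => _ [mu [nu [_ _ ->]]]; exact: probability_le1.
Qed.

(** There are countably many words, so the null cylinders together form a null set. *)
Lemma measure_null_cyl (R : realType) (X : finType) (x0 : X)
    (nu : {measure set (path_space x0) -> \bar R}) :
  let V := [set r : path_space x0 | forall n, nu (cyl (mkseq r n)) != 0%E] in
  measurable V /\ nu (~` V) = 0%E.
Proof.
move=> V; have mV : measurable V.
  rewrite (_ : V = \bigcap_n [set r : path_space x0 | nu (cyl (mkseq r n)) != 0%E]).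
    apply: bigcapT_measurable => n.
    exact: (measurable_prefix n [set w | nu (cyl w) != 0%E]).
  by apply/seteqP; split=> r Vr n; [move=> _|]; exact: Vr.
split=> //; pose F k := if unpickle k is Some w then
  if nu (cyl w) == 0%E then cyl w : set (path_space x0) else set0 else set0.
apply: (measure_negligible (measurableC mV)).
have FN : nu.-negligible (\bigcup_k F k).
  apply: negligible_bigcup => k; rewrite /F.
  case: unpickle => [w|]; last exact: negligible_set0.
  case: eqP => [w0|_]; last exact: negligible_set0.
  by apply/negligibleP => //; exact: measurable_cyl.
apply: negligibleS FN => r /existsNP[n /negP/negPn nr].
exists (pickle (mkseq r n)) => //; rewrite /F pickleK nr; exact: cyl_mkseq.
Qed.

(** * Comparison of two MDPs *)

Section Simulation.
Variables (R : realType) (X1 B1 X2 B2 : finType).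
Variables (avail1 : X1 -> B1 -> bool) (P1 : X1 -> B1 -> X1 -> R) (x1 : X1).
Variables (avail2 : X2 -> B2 -> bool) (P2 : X2 -> B2 -> X2 -> R).
Hypotheses (M1 : is_mdp avail1 P1) (M2 : is_mdp avail2 P2).
Variables (f : X1 -> X2) (beta : X1 -> B1 -> B2) (g : X1 -> R).

(* The sum of [F] over the words that [f] maps to [rev v]. *)
Fixpoint lift_sum (v : seq X2) (F : seq X1 -> R) : R :=
  if v is x :: v' then
    lift_sum v' (fun u => \sum_(y | f y == x) F (rcons u y)) else F [::].

Lemma eq_lift_sum v F G : F =1 G -> lift_sum v F = lift_sum v G.
Proof.
elim: v F G => [|x v IH] F G FG /=; first exact: FG.
by apply: IH => u; apply: eq_bigr => y _; rewrite FG.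
Qed.

Lemma le_lift_sum v F G : (forall u, F u <= G u) -> lift_sum v F <= lift_sum v G.
Proof.
elim: v F G => [|x v IH] F G FG /=; first exact: FG.
by apply: IH => u; apply: ler_sum => y _; rewrite FG.
Qed.

Lemma lift_sum0 v F : (forall u, F u = 0) -> lift_sum v F = 0.
Proof.
elim: v F => [|x v IH] F F0 /=; first exact: F0.
by apply: IH => u; rewrite big1.
Qed.

Lemma lift_sum_ge0 v F : (forall u, 0 <= F u) -> 0 <= lift_sum v F.
Proof. by move=> F0; rewrite -(@lift_sum0 v (fun=> 0))// le_lift_sum. Qed.

Lemma lift_sum_lin v (k : B2 -> seq X1 -> R) (c : B2 -> R) :
  lift_sum v (fun u => \sum_b k b u * c b) = \sum_b lift_sum v (k b) * c b.
Proof.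
elim: v k => [//|x v IH] k /=; rewrite -IH; apply: eq_lift_sum => u.
by rewrite exchange_big; apply: eq_bigr => b _; rewrite mulr_suml.
Qed.

(** Induction on the word: the constraint on its last letter moves into [D], which is why [D] is
    arbitrary. *)
Lemma measure_lift_sum (nu : {measure set (path_space x1) -> \bar R})
    (D : set (path_space x1)) v (F : seq X1 -> R) : measurable D ->
  (forall w, size w = size v -> (nu (D `&` cyl w) <= (F w)%:E)%E) ->
  (nu (D `&` path_map (f x1) f @^-1` cyl (rev v)) <= (lift_sum v F)%:E)%E.
Proof.
elim: v D F => [|x v IH] D F mD DF.
  by rewrite /= cyl_nil preimage_setT -(cyl_nil x1) DF.
pose A := [set r : path_space x1 | f (r (size v)) = x].
have mA : measurable A by exact: (measurable_at (size v) [set y | f y = x]).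
have mDA : measurable (D `&` A) by exact: measurableI.
rewrite rev_cons (_ : D `&` _ =
    (D `&` A) `&` path_map (f x1) f @^-1` cyl (rev v)); last first.
  apply/seteqP; split=> r /=.
    by rewrite /preimage /= => -[Dr /cyl_rcons[vr]]; rewrite size_rev.
  rewrite /preimage /= => -[[Dr Ar] vr]; split=> //.
  by apply/cyl_rcons; rewrite size_rev.
apply: IH => // u uv; rewrite setIC measure_cyl_split// -sumEFin.
rewrite [leRHS]big_mkcond /=; apply: lee_sum => y _; case: eqP => [fy|fy].
  apply: le_trans (DF (rcons u y) _); last by rewrite size_rcons uv.
  apply: le_measure; rewrite ?inE; first exact: measurableI (measurable_cyl _) mDA.
    exact: measurableI mD (measurable_cyl _).
  by move=> r [cr [Dr _]].
rewrite (_ : _ `&` _ = set0) ?measure0//; apply/seteqP; split=> // r.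
by move=> [/cyl_rcons[_ yr] [_]]; rewrite /A /= -uv yr.
Qed.

Hypothesis g_ge0 : forall x, 0 <= g x.
Hypothesis beta_avail : forall x b, avail1 x b -> avail2 (f x) (beta x b).
Hypothesis sim_le : forall x b y, avail1 x b ->
  \sum_(z | f z == y) P1 x b z * g z <= P2 (f x) (beta x b) y * g x.

(* The potential [g] bounds how much likelier a history is in the first MDP. *)
Lemma simulation (E1 : set (path_space x1)) (E2 : set (path_space (f x1))) :
  measurable E1 -> measurable E2 ->
  (forall r, r 0%N = x1 ->
     (forall n, exists2 b, avail1 (r n) b & 0 < P1 (r n) b (r n.+1)) -> E1 r ->
     E2 (f \o r) /\ forall n, 1 <= g (r n)) ->
  (max_prob (x0 := x1) avail1 P1 E1 <=
   (g x1)%:E * max_prob (x0 := f x1) avail2 P2 E2)%E.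
Proof.
move=> mE1 mE2 E12; apply: ge_ereal_sup => _ [mu [nu [smu numu ->]]].
have /choice[e eP] : forall ux : seq X1 * X1, exists e,
    is_flow avail1 P1 nu ux.1 ux.2 e.
  by move=> [u x]; exact: (strategy_flow M1 smu numu).
(* On [V] every prefix has positive mass, so each transition has positive probability under some
   available action, as the hypothesis on [E1] and [E2] requires. *)
pose V := [set r : path_space x1 | forall n, nu (cyl (mkseq r n)) != 0%E].
have [mV V0] : measurable V /\ nu (~` V) = 0%E by exact: measure_null_cyl.
have mD : measurable (E1 `&` V) by exact: measurableI.
have fin w : nu (cyl w) \is a fin_num by apply: fin_num_measure; exact: measurable_cyl.
pose mass w := fine (nu (cyl w)).
have massE w : nu (cyl w) = (mass w)%:E by rewrite fineK.
have mass_ge0 w : 0 <= mass w by rewrite fine_ge0.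
have mass1 x : mass [:: x] = (x == x1)%:R by rewrite /mass numu /= mulr1.
have DE r : (E1 `&` V) r -> E2 (f \o r) /\ forall n, 1 <= g (r n).
  move=> [Er Vr]; apply: E12 => // [|n].
    have : nu (cyl [:: r 0%N]) != 0%E by exact: (Vr 1%N).
    by rewrite massE mass1 eqe; case: (r 0%N =P x1); rewrite ?eqxx.
  have : nu (cyl (rcons (rcons (mkseq r n) (r n)) (r n.+1))) != 0%E.
    by rewrite -!mkseqS; exact: (Vr n.+2).
  have [e0 ea _ ->] := eP (mkseq r n, r n); rewrite eqe /=.
  rewrite psumr_neq0 => [/hasP[b _ /= eb]|b _]; last first.
    by apply: (mulr_trans_ge0 M1) => // /ea.
  have ebp : 0 < e (mkseq r n, r n) b.
    by rewrite lt_def e0 andbT; apply: contraTneq eb => ->; rewrite mul0r ltxx.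
  by exists b; [exact: ea|move: eb; rewrite pmulr_rgt0].
(* Image under [f] of [nu] restricted to the relevant runs, all of which land in [E2]. *)
have [mu2 mu2E] := measure_image nu mD (measurable_path_map x1 (f x1) f).
have -> : nu E1 = mu2 E2.
  rewrite mu2E setIidl; last by move=> r /DE[].
  apply/eqP; rewrite eq_le measureIl// andbT.
  apply: (@le_trans _ _ (nu (E1 `&` V) + nu (~` V))%E); last by rewrite V0 adde0.
  apply: le_trans (measureU2 _ mD (measurableC mV)).
  apply: le_measure; rewrite ?inE//.
    by apply: measurableU => //; exact: measurableC.
  by move=> r Er; have [Vr|Vr] := pselect (V r); [left|right].
(* Masses and flows of the first MDP, weighted by the potential of the current state and summed over
   the fibres of [f]. *)
pose m w := lift_sum (rev w) (fun w' => mass w' * g (last x1 w')).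
pose e2 u x b := lift_sum (rev u) (fun u' => \sum_(y | f y == x)
   \sum_(c | beta y c == b) e (u', y) c * g y).
have mS u x : m (rcons u x) = lift_sum (rev u) (fun u' => \sum_(y | f y == x)
    mass (rcons u' y) * g y).
  rewrite /m rev_rcons /=; apply: eq_lift_sum => u'; apply: eq_bigr => y _.
  by rewrite last_rcons.
have e_ge0 u y b : 0 <= e (u, y) b by have [] := eP (u, y).
have e_term u x y b : f y == x ->
    \sum_(c | beta y c == b) e (u, y) c * g y = 0 \/ avail2 x b.
  move=> /eqP <-; have [|nb] := boolP (avail2 (f y) b); first by right.
  left; rewrite big1// => c /eqP cb; have [_ ea _ _] := eP (u, y).
  have [->|ec] := eqVneq (e (u, y) c) 0; first by rewrite mul0r.
  by case/negP: nb; rewrite -cb; apply/beta_avail/ea; rewrite lt_def ec e_ge0.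
have e2_ge0 u x b : 0 <= e2 u x b.
  apply: lift_sum_ge0 => u'; apply: sumr_ge0 => y _; apply: sumr_ge0 => c _.
  by rewrite mulr_ge0.
apply: (@le_max_prob _ _ _ avail2 P2 M2 (f x1) (g x1) m e2) => //.
- move=> x; rewrite /m /=; case: (eqVneq x (f x1)) => [->|xf].
    rewrite mulr1 (bigD1 x1)//= mass1 eqxx mul1r big1 ?addr0// => y /andP[_ yx].
    by rewrite mass1 (negbTE yx) mul0r.
  rewrite mulr0 big1// => y fy; rewrite mass1.
  case: eqVneq => [yx|_]; last by rewrite mul0r.
  by move: fy xf; rewrite yx eq_sym => ->.
- move=> u x b; apply: contraTT => nb; rewrite -leNgt /e2 lift_sum0// => u'.
  rewrite big1// => y fy.
  by case: (e_term u' x y b fy) => [->//|]; rewrite (negbTE nb).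
- move=> u x; rewrite mS.
  have := lift_sum_lin (rev u) (fun b u' => \sum_(y | f y == x)
     \sum_(c | beta y c == b) e (u', y) c * g y) (fun=> 1).
  under [X in _ = X -> _]eq_bigr do rewrite mulr1.
  move=> <-; apply: le_lift_sum => u'; under eq_bigr do rewrite mulr1.
  rewrite exchange_big; apply: ler_sum => y _.
  have [_ _ + _] := eP (u', y); rewrite massE /= => -[->].
  by rewrite mulr_suml [leRHS](partition_big (beta y) predT).
- move=> u x y; rewrite mS rev_rcons /=.
  rewrite -(lift_sum_lin (rev u) _ (fun b => P2 x b y)).
  apply: le_lift_sum => u'.
  under [leRHS]eq_bigr do rewrite mulr_suml.
  rewrite [leRHS]exchange_big /=; apply: ler_sum => z /eqP fz.
  have [_ ea _ eS] := eP (u', z).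
  under eq_bigr => t _.
    have := eS t; rewrite massE => -[->]; rewrite mulr_suml; over.
  rewrite exchange_big /=.
  rewrite [leRHS](_ : _ = \sum_c e (u', z) c * g z * P2 x (beta z c) y); last first.
    rewrite [RHS](partition_big (beta z) predT)//=; apply: eq_bigr => b _.
    by rewrite mulr_suml; apply: eq_bigr => c /eqP ->.
  apply: ler_sum => c _; have [ec|ec] := eqVneq (e (u', z) c) 0.
    by rewrite ec !mul0r big1// => t _; rewrite !mul0r.
  under eq_bigr do rewrite -mulrA; rewrite -mulr_sumr -mulrA ler_wpM2l//.
  by rewrite mulrC -fz sim_le// ea// lt_def ec e_ge0.
(* A cylinder that meets the restricted event ends in a state of potential at least 1, so weighting
   by [g] does not decrease its mass. *)
- move=> u x; rewrite mu2E -{1}(revK (rcons u x)); apply: measure_lift_sum => // w.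
  rewrite size_rev size_rcons; case/lastP: w => [//|w y _].
  have [e0|/set0P[r [Dr wr]]] := eqVneq (E1 `&` V `&` cyl (rcons w y)) set0.
    by rewrite e0 measure0 lee_fin mulr_ge0.
  apply: (@le_trans _ _ (nu (cyl (rcons w y)))).
    by apply: measureIr => //; exact: measurable_cyl.
  rewrite massE lee_fin ler_peMr// last_rcons.
  by case/cyl_rcons: wr => _ <-; have [_] := DE r Dr.
Qed.

End Simulation.

(** * Conditioning on a history and prefixing a step *)

Section OneStep.
Variables (R : realType) (X B : finType).
Variables (avail : X -> B -> bool) (P : X -> B -> X -> R).
Hypothesis M : is_mdp avail P.

(** Flows of [nu] after the history [u] are flows of an MDP started in [x], up to the mass of the
    history. That mass stays as a factor, so null histories need no separate treatment. *)
Lemma conditional_le_max_prob x0 (nu : probability (path_space x0) R) u x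
    (E : set (path_space x)) :
  (forall v z, exists e, is_flow avail P nu v z e) -> measurable E ->
  (nu (cyl (rcons u x) `&` path_shift (x0 := x0) x (size u) @^-1` E) <=
   nu (cyl (rcons u x)) * max_prob (x0 := x) avail P E)%E.
Proof.
move=> flow mE.
have /choice[e eP] : forall vz : seq X * X, exists e,
    is_flow avail P nu vz.1 vz.2 e by move=> [v z]; exact: flow.
have massE w : nu (cyl w) = (fine (nu (cyl w)))%:E.
  by rewrite fineK// fin_num_measure//; exact: measurable_cyl.
pose mass w := fine (nu (cyl w)).
have mass_ge0 w : 0 <= mass w by rewrite fine_ge0.
have [mu muE] := measure_image nu (measurable_cyl (rcons u x))
  (measurable_path_shift x0 x (size u)).
rewrite -muE [nu _]massE.
pose m w := if head x w == x then mass (u ++ w) else 0.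
pose e' v z b := if head x (rcons v z) == x then e (u ++ v, z) b else 0.
apply: (@le_max_prob _ _ _ avail P M x (mass (rcons u x)) m e') => //.
- move=> z; rewrite /m /= cats1; case: eqVneq => [->|_]; first by rewrite mulr1.
  by rewrite mulr0.
- by move=> v z b; rewrite /e'; case: ifP => // _; have [] := eP (u ++ v, z).
- move=> v z b; rewrite /e'; case: ifP; last by rewrite ltxx.
  by move=> _; have [_ + _ _] := eP (u ++ v, z); apply.
- move=> v z; rewrite /m /e'; case: ifP => [_|_]; last by rewrite big1.
  by have [_ _ + _] := eP (u ++ v, z); rewrite /mass -rcons_cat massE => -[->].
- move=> v z y; rewrite /m /e'.
  have -> : head x (rcons (rcons v z) y) = head x (rcons v z) by case: v.
  case: ifP => [_|_]; last by rewrite big1// => b _; rewrite mul0r.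
  have [_ _ _ /(_ y)] := eP (u ++ v, z); rewrite /mass -!rcons_cat massE => -[->].
  by [].
- move=> v z; rewrite muE /m; case: ifP => [_|/eqP hx].
    rewrite /mass -massE; apply: le_measure; rewrite ?inE.
    + apply: measurableI; first exact: measurable_cyl.
      rewrite -[X in measurable X]setTI.
      by apply: (measurable_path_shift x0 x (size u)) => //; exact: measurable_cyl.
    + exact: measurable_cyl.
    + by move=> r [/cyl_rcons[ur _] vr]; apply/cyl_cat.
  rewrite (_ : _ `&` _ = set0) ?measure0//; apply/seteqP; split=> // r.
  move=> [/cyl_rcons[_ rx] vr]; apply: hx.
  have {vr} <- : mkseq (path_shift x (size u) r) (size (rcons v z)) = rcons v z.
    exact: vr.
  by rewrite size_rcons /= /path_shift addn0.
Qed.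

Lemma measure_wsum d (T : measurableType d) (I : finType)
    (nu : I -> {measure set T -> \bar R}) (c : I -> R) :
  (forall i, 0 <= c i) -> exists mu : {measure set T -> \bar R},
  forall A, mu A = (\sum_i (c i)%:E * nu i A)%E.
Proof.
move=> c0; suff [mu muE] : exists mu : {measure set T -> \bar R},
    forall A, mu A = (\sum_(i <- enum I) (c i)%:E * nu i A)%E.
  by exists mu => A; rewrite muE big_enum.
elim: (enum I) => [|i s [mu muE]]; first by exists mzero => A; rewrite big_nil.
exists (measure_add (mscale (NngNum (c0 i)) (nu i)) mu) => A.
by apply: etrans (measure_addE _ _ _) _; rewrite muE big_cons.
Qed.

(** Play [b], then a nearly optimal strategy from the successor. The supremum need not be attained,
    hence the argument up to each positive [eps]. *)
Lemma one_step_max_prob x b (E : set (path_space x))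
    (Es : forall y, set (path_space y)) :
  avail x b -> measurable E -> (forall y, measurable (Es y)) ->
  (forall y, Es y `<=` path_cons (x0 := y) x @^-1` E) ->
  (forall y, 0 < P x b y -> (1 <= max_prob (x0 := y) avail P (Es y))%E) ->
  (1 <= max_prob (x0 := x) avail P E)%E.
Proof.
move=> xb mE mEs EsE Es1; apply/lee_addgt0Pr => eps eps0.
have [P0 P1] := M.2 _ _ xb.
have nu_ex : forall y, exists nu : {measure set (path_space y) -> \bar R},
    [/\ forall v z, exists e, is_flow avail P nu v z e,
        forall z, (nu (cyl [:: z]) <= ((z == y)%:R)%:E)%E,
        (nu setT <= 1)%E & 0 < P x b y -> ((1 - eps)%:E <= nu (Es y))%E].
  (* Nothing is assumed about successors of probability 0; the zero measure stands in for them. *)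
  move=> y; have [Py|Py] := ltP 0 (P x b y); last first.
    exists mzero; split=> [v z|z||//]; [|by rewrite lee_fin|exact: lee01].
    exists (fun=> 0); split=> [//|c|/=|t /=]; rewrite ?ltxx// big1// => c _.
    by rewrite mul0r.
  have : ((1 - eps)%:E < max_prob (x0 := y) avail P (Es y))%E.
    by apply: lt_le_trans (Es1 y Py); rewrite lte_fin ltrBlDr ltrDl.
  move=> /ereal_sup_gt[_ [mu [nu [smu numu ->]]] /ltW lnu].
  exists nu; split=> //; first exact: strategy_flow numu.
    by move=> z; rewrite /= numu /= mulr1.
  exact: probability_le1.
pose nu y := projT1 (cid (nu_ex y)).
have nuP y := projT2 (cid (nu_ex y)); rewrite -/(nu _) in nuP.
have flow y : forall v z, exists e, is_flow avail P (nu y) v z e by case: (nuP y).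
have nu1 y : forall z, (nu y (cyl [:: z]) <= ((z == y)%:R)%:E)%E by case: (nuP y).
have nuT y : (nu y setT <= 1)%E by case: (nuP y).
have nuE y : 0 < P x b y -> ((1 - eps)%:E <= nu y (Es y))%E by case: (nuP y).
have /choice[e eP] : forall yvz : X * seq X * X, exists e,
    is_flow avail P (nu yvz.1.1) yvz.1.2 yvz.2 e by move=> [[y v] z]; exact: flow.
pose mass y w := fine (nu y (cyl w)).
have massE y w : nu y (cyl w) = (mass y w)%:E.
  rewrite fineK// ge0_fin_numE//; apply: le_lt_trans (ltry 1).
  apply: le_trans (nuT y); apply: le_measure; rewrite ?inE//.
  exact: measurable_cyl.
have nu'_ex : forall y, exists nu' : {measure set (path_space x) -> \bar R},
    forall A, nu' A = nu y (path_cons (x0 := y) x @^-1` A).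
  move=> y; have [nu' nu'E] := measure_image (nu y) measurableT
    (measurable_path_cons y x).
  by exists nu' => A; rewrite nu'E setTI.
pose nu' y := projT1 (cid (nu'_ex y)).
have nu'E y : forall A, nu' y A = nu y (path_cons (x0 := y) x @^-1` A).
  exact: projT2 (cid (nu'_ex y)).
have [mu muE] := measure_wsum nu' P0.
have consE y z w : path_cons (x0 := y) x @^-1` cyl (z :: w) =
    (if z == x then cyl w else set0) :> set (path_space y).
  apply/seteqP; split=> r; rewrite /preimage /= -cat1s.
    move=> /cyl_cat[/cylP[<-] wr]; rewrite /= eqxx.
    by move: wr; rewrite !cylP.
  case: eqVneq => // -> wr; apply/cyl_cat; split; first by rewrite cylP.
  by move: wr; rewrite !cylP.
have mucons z w : mu (cyl (z :: w)) =
    ((z == x)%:R * \sum_y P x b y * mass y w)%:E.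
  rewrite muE EFinM -sumEFin ge0_sume_distrr; last first.
    by move=> y _; rewrite lee_fin mulr_ge0// fine_ge0.
  apply: eq_bigr => y _; rewrite nu'E consE; case: eqP => _.
    by rewrite mul1e massE -EFinM.
  by rewrite measure0 mule0 mul0e.
(* On one-state words [m] is the whole unit of mass spent on [b]; [mu] may have less, as its
   components are only known to have mass at most 1. *)
pose m w := if w is [:: z] then (z == x)%:R else fine (mu (cyl w)).
pose e' v z c : R := if v is z0 :: v' then
    (z0 == x)%:R * \sum_y P x b y * e (y, v', z) c
  else (z == x)%:R * (c == b)%:R.
have mS2 z0 v z : m (z0 :: rcons v z) = fine (mu (cyl (z0 :: rcons v z))).
  by case: v.
have e_ge0 y v z c : 0 <= e (y, v, z) c by have [] := eP (y, v, z).
suff muE1 : (mu E <= max_prob (x0 := x) avail P E)%E.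
  apply: le_trans (leeD2r _ muE1).
  rewrite -leeBlDr//; apply: (@le_trans _ _ (\sum_y (P x b y)%:E * (1 - eps)%:E)%E).
    rewrite -ge0_sume_distrl => [|y _]; last by rewrite lee_fin.
    by rewrite sumEFin P1 mul1e.
  rewrite muE; apply: lee_sum => y _; have [Py|] := ltP 0 (P x b y); last first.
    by move=> Py; rewrite (_ : P x b y = 0) ?mul0e//; apply/eqP; rewrite eq_le Py P0.
  rewrite lee_pmul2l ?lte_fin//; apply: le_trans (nuE y Py) _.
  rewrite nu'E; apply: le_measure; rewrite ?inE//; last exact: EsE.
  by rewrite -[X in measurable X]setTI; exact: measurable_path_cons.
have := @le_max_prob _ _ _ avail P M x 1 m e' mu E; rewrite mul1e; apply=> //.
- by move=> z; rewrite mul1r.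
- case=> [|z0 v] z c /=; first by rewrite mulr_ge0.
  by rewrite mulr_ge0// sumr_ge0// => y _; rewrite mulr_ge0.
- case=> [|z0 v] z c /=.
    case: eqVneq => [->|]; rewrite ?mul0r ?ltxx// mul1r.
    by case: eqVneq => [->|]; rewrite ?ltxx.
  apply: contraTT => nc; rewrite -leNgt big1 ?mulr0// => y _.
  have [_ ea _ _] := eP (y, v, z); have [->|ec] := eqVneq (e (y, v, z) c) 0.
    by rewrite mulr0.
  by case/negP: nc; apply: ea; rewrite lt_def ec e_ge0.
- case=> [|z0 v] z.
    by rewrite /= -mulr_sumr (bigD1 b)//= eqxx big1 ?addr0 ?mulr1// => c /negbTE ->.
  rewrite rcons_cons mS2 mucons /= -mulr_sumr exchange_big ler_wpM2l//.
  apply: ler_sum => y _; rewrite -mulr_sumr.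
  rewrite ler_wpM2l//.
  by have [_ _ + _] := eP (y, v, z); rewrite massE => -[->].
- case=> [|z0 v] z y.
    rewrite /= mucons /= (bigD1 b)//= eqxx mulr1 [X in _ <= _ + X]big1; last first.
      by move=> c /negbTE ->; rewrite mulr0 mul0r.
    case: eqVneq => [->|_]; rewrite ?mul0r ?addr0 ?mul1r// (bigD1 y)//= big1.
      rewrite addr0 ler_piMr// -lee_fin -massE.
      by have := nu1 y y; rewrite eqxx.
    move=> t ty; apply/eqP; rewrite mulf_eq0; apply/orP; right.
    rewrite eq_le fine_ge0// andbT -lee_fin -massE.
    by have := nu1 t y; rewrite eq_sym (negbTE ty).
  rewrite !rcons_cons mS2 mucons /=.
  under [leRHS]eq_bigr do rewrite -mulrA; rewrite -mulr_sumr ler_wpM2l//.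
  under [leRHS]eq_bigr do rewrite mulr_suml.
  rewrite [leRHS]exchange_big /=; apply: ler_sum => t _.
  have [_ _ _ /(_ y)] := eP (t, v, z); rewrite massE => -[->].
  by rewrite mulr_sumr; apply: ler_sum => c _; rewrite mulrA.
- case=> [|z0 v] z.
    rewrite mucons lee_fin ler_piMr//.
    apply: (@le_trans _ _ (\sum_y P x b y)); last by rewrite P1.
    apply: ler_sum => y _; rewrite ler_piMr//.
    by rewrite -lee_fin -massE cyl_nil.
  by rewrite rcons_cons mS2 mucons.
Qed.

End OneStep.

(** * Measurability of acceptance *)

Section Acceptance.
Variables (Sigma : finType) (N : nbw Sigma).
Local Notation Q := (nstate N).
Implicit Types (T U : {set Q}) (w : nat -> Sigma).

Definition accepts_from T w : Prop := exists rho : nat -> Q,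
  [/\ rho 0%N \in T, forall i, rho i.+1 \in ndelta (rho i) (w i) &
      forall n, exists2 i, (n <= i)%N & rho i \in nacc N].

Lemma nbw_acceptsE w : nbw_accepts N w <-> accepts_from [set ninit N]%SET w.
Proof.
split=> [[rho [r0 [rS rF]]]|[rho [/finset.set1P r0 rS rF]]]; exists rho => //.
by split=> //; rewrite r0 finset.set11.
Qed.

Definition post T (a : Sigma) : {set Q} :=
  [set q | [exists p in T, q \in ndelta p a]]%SET.

Lemma accepts_from_post T w :
  accepts_from T w <-> accepts_from (post T (w 0%N)) (fun n => w n.+1).
Proof.
split=> -[rho [r0 rS rF]].
  exists (fun n => rho n.+1); split=> [|//|n].
    by rewrite finset.inE; apply/existsP; exists (rho 0%N); rewrite r0 rS.
  by have [[|i]] := rF n.+1 => // ni Fi; exists i.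
move: r0; rewrite finset.inE => /existsP[p /andP[pT pr]].
exists (fun n => if n is m.+1 then rho m else p); split=> // [[|i]//|n].
by have [i ni Fi] := rF n; exists i.+1; rewrite // ltnW.
Qed.

Fixpoint reach T w n : {set Q} :=
  if n is m.+1 then post (reach T w m) (w m) else T.

Lemma eq_reach T w w' n : (forall i, (i < n)%N -> w i = w' i) ->
  reach T w n = reach T w' n.
Proof.
elim: n => // n IH ww' /=; rewrite ww'// IH// => i /ltnW; exact: ww'.
Qed.

Lemma accepts_from_reach T w n :
  accepts_from T w <-> accepts_from (reach T w n) (fun i => w (n + i)%N).
Proof.
elim: n => // n ->; rewrite accepts_from_post /= addn0.
by under [in X in _ <-> X]eq_fun do rewrite addSnnS.
Qed.

(** A true flag demands an accepting state, a false one demands nothing, so the flags of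
    concatenated segments combine by disjunction. The end state is not tested: it belongs to the
    next segment. *)
Definition segment w i j p q (b : bool) : Prop := exists rho : nat -> Q,
  [/\ rho i = p, rho j = q,
      forall k, (i <= k < j)%N -> rho k.+1 \in ndelta (rho k) (w k) &
      b -> exists2 k, (i <= k < j)%N & rho k \in nacc N].

Lemma segment_cat w i k l p r q b1 b2 : (i <= k)%N -> (k <= l)%N ->
  segment w i k p r b1 -> segment w k l r q b2 -> segment w i l p q (b1 || b2).
Proof.
move=> ik kl [rho1 [r1i r1k r1S r1F]] [rho2 [r2k r2l r2S r2F]].
exists (fun n => if (n < k)%N then rho1 n else rho2 n); split.
- case: ltnP => // ki; have e : i = k by apply/eqP; rewrite eqn_leq ik.
  by rewrite e r2k -r1k -e.
- by rewrite ltnNge kl.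
- move=> n /andP[iN nl]; case: (ltnP n k) => nk.
    case: ltnP => [_|kn]; first by rewrite r1S// iN.
    have e : k = n.+1 by apply/eqP; rewrite eqn_leq kn.
    by rewrite -e r2k -r1k e r1S// iN.
  by rewrite ltnNge (leqW nk) /= r2S// nk.
- case/orP=> [/r1F[n /andP[iN nk] Fn]|/r2F[n /andP[kn nl] Fn]].
    by exists n; rewrite ?nk// iN (leq_trans nk).
  by exists n; rewrite ?nl ?(leq_trans ik kn)// ltnNge kn.
Qed.

Lemma segment_split w i k l p q b : (i <= k)%N -> (k <= l)%N ->
  segment w i l p q b -> exists r b1 b2,
    [/\ segment w i k p r b1, segment w k l r q b2 & b1 || b2 = b].
Proof.
move=> ik kl [rho [ri rl rS rF]]; exists (rho k).
have seg (c1 c2 : bool) : (c1 -> exists2 n, (i <= n < k)%N & rho n \in nacc N) ->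
    (c2 -> exists2 n, (k <= n < l)%N & rho n \in nacc N) ->
    segment w i k p (rho k) c1 /\ segment w k l (rho k) q c2.
  move=> H1 H2; split; exists rho; split=> // n /andP[n1 n2]; apply: rS.
    by rewrite n1 (leq_trans n2).
  by rewrite n2 (leq_trans ik).
case: b rF => [/(_ isT)[n /andP[iN nl] Fn]|_]; last first.
  by exists false, false; have [] := seg false false.
case: (ltnP n k) => nk.
  exists true, false; have [] // := seg true false => // _.
  by exists n; rewrite ?iN.
exists false, true; have [] // := seg false true => // _.
by exists n; rewrite ?nk.
Qed.

(** The transition profile of Buchi's congruence: it takes finitely many values and is compositional
    under concatenation. *)
Definition profile w i j : {set Q * Q * bool} :=
  [set t | `[< segment w i j t.1.1 t.1.2 t.2 >]]%SET.

Lemma profileP w i j p q b :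
  reflect (segment w i j p q b) ((p, q, b) \in profile w i j).
Proof. by rewrite finset.inE; exact: asboolP. Qed.

Lemma eq_profile w w' i j : (forall n, (n < j)%N -> w n = w' n) ->
  profile w i j = profile w' i j.
Proof.
move=> ww'; apply/finset.setP => -[[p q] b].
apply/profileP/profileP => -[rho [ri rj rS rF]]; exists rho; split=> // k ikj.
  by rewrite -ww' ?rS//; case/andP: ikj.
by rewrite ww' ?rS//; case/andP: ikj.
Qed.

Lemma profile_merge w i j k l : (i <= k)%N -> (j <= k)%N -> (k <= l)%N ->
  profile w i k = profile w j k -> profile w i l = profile w j l.
Proof.
move=> ik jk kl e; apply/finset.setP => -[[p q] b].
apply/profileP/profileP => /segment_split.
  move=> /(_ k ik kl)[r [b1 [b2 [/profileP + s2 <-]]]].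
  by rewrite e => /profileP s1; exact: segment_cat s1 s2.
move=> /(_ k jk kl)[r [b1 [b2 [/profileP + s2 <-]]]].
by rewrite -e => /profileP s1; exact: segment_cat s1 s2.
Qed.

Lemma profile_shift w n i j :
  profile (fun m => w (n + m)%N) i j = profile w (n + i) (n + j).
Proof.
apply/finset.setP => -[[p q] b].
apply/profileP/profileP => -[rho [ri rj rS rF]].
  exists (fun m => rho (m - n)%N); rewrite !addKn; split=> // [k|/rF[k ikj Fk]].
    move=> /andP[ik kj]; have nk : (n <= k)%N by rewrite (leq_trans _ ik)// leq_addr.
    rewrite subSn// -{3}(subnKC nk); apply: rS.
    by rewrite leq_subRL// ik ltn_subLR.
  by exists (n + k)%N; rewrite ?leq_add2l ?ltn_add2l// addKn.
exists (fun m => rho (n + m)%N); split=> // [k /andP[ik kj]|/rF[k /andP[ik kj] Fk]].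
  by rewrite addnS; apply: rS; rewrite leq_add2l ltn_add2l ik.
have nk : (n <= k)%N by rewrite (leq_trans _ ik)// leq_addr.
by exists (k - n)%N; rewrite ?subnKC// leq_subRL// ik ltn_subLR.
Qed.

(* Unlike the existence of a factorization into words of profile [e], this     *)
(* equivalent condition is visibly a countable combination of cylinders.       *)
Definition homogeneous w e : Prop := forall n, exists j,
  [/\ (n <= j)%N, profile w 0 j = e &
      exists2 k, (j <= k)%N & profile w 0 k = profile w j k].

(** The next cut is chosen beyond the point where 0 and the current cut [j] merge; the profile from
    [j] then equals the profile from 0, which is [e]. *)
Lemma homogeneous_factorization w e : homogeneous w e -> exists j : nat -> nat,
  [/\ j 0%N = 0%N, forall l, (j l < j l.+1)%N &
      forall l, profile w (j l) (j l.+1) = e].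
Proof.
move=> hom; pose merged j := exists2 k, (j <= k)%N & profile w 0 k = profile w j k.
have /choice[nxt nxtP] : forall j, exists j', merged j ->
    [/\ (j < j')%N, profile w j j' = e & merged j'].
  move=> j; have [[k jk ek]|nm] := pselect (merged j); last by exists 0%N.
  have [j' [+ e0 mj']] := hom (maxn k j.+1); rewrite geq_max => /andP[kj' jj'].
  exists j' => _; split=> //; rewrite -e0; apply/esym.
  exact: (profile_merge _ jk kj' ek).
exists (fun l => iter l nxt 0%N).
have mj l : merged (iter l nxt 0%N).
  by elim: l => [|l /nxtP[]//]; exists 0%N.
by split=> // l; have [] := nxtP _ (mj l).
Qed.

Section Blocks.
Variable j : nat -> nat.
Hypotheses (j0 : j 0%N = 0%N) (jS : forall l, (j l < j l.+1)%N).

Lemma blocks_mono m n : (m <= n)%N -> (j m <= j n)%N.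
Proof.
by apply: (@homo_leq _ j leq) => //; [exact: leq_trans|move=> l; exact: ltnW].
Qed.

Lemma blocks_ge l : (l <= j l)%N.
Proof. by elim: l => // l IH; exact: leq_ltn_trans IH (jS l). Qed.

Lemma blocks_cover n : exists l, (j l <= n < j l.+1)%N.
Proof.
elim: n => [|n [l /andP[ln nl]]]; first by exists 0%N; move: (jS 0%N); rewrite j0.
case: (ltnP n.+1 (j l.+1)) => h; first by exists l; rewrite h leqW.
by exists l.+1; rewrite h (leq_ltn_trans nl (jS _)).
Qed.

Lemma blocks_uniq n l m :
  (j l <= n < j l.+1)%N -> (j m <= n < j m.+1)%N -> l = m.
Proof.
wlog lm : l m / (l <= m)%N.
  by move=> W hl hm; case: (leqP l m) => [|/ltnW] h; [|apply/esym]; exact: W.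
move=> /andP[_ nl] /andP[mn _]; apply/eqP; rewrite eqn_leq lm leqNgt.
by apply/negP => /blocks_mono h; move: (leq_trans nl (leq_trans h mn)); rewrite ltnn.
Qed.

End Blocks.

Definition profile_accepts U (e : {set Q * Q * bool}) : Prop :=
  exists (p : nat -> Q) (c : nat -> bool),
  [/\ p 0%N \in U, forall l, (p l, p l.+1, c l) \in e &
      forall n, exists2 l, (n <= l)%N & c l].

(** A run sampled at the block ends gives the abstract sequence; conversely, the segments witnessing
    the profiles of the blocks are glued. *)
Lemma homogeneous_accepts U w e : homogeneous w e ->
  accepts_from U w <-> profile_accepts U e.
Proof.
move=> /homogeneous_factorization[j [j0 jS je]].
have /choice[idx idxP] := blocks_cover j0 jS.
have idxE := fun n l => @blocks_uniq j jS n (idx n) l (idxP n).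
split=> [[rho [r0 rS rF]]|[p [c [p0 pS cF]]]].
  exists (fun l => rho (j l)), (fun l => `[< exists2 k,
    (j l <= k < j l.+1)%N & rho k \in nacc N >]); split=> [|l|n].
  - by rewrite j0.
  - by rewrite -(je l); apply/profileP; exists rho; split=> // /asboolP.
  - have [k nk Fk] := rF (j n); exists (idx k); last by apply/asboolP; exists k.
    rewrite leqNgt; apply/negP => /(blocks_mono jS) h.
    by have /andP[_] := idxP k; rewrite ltnNge (leq_trans h nk).
have /choice[rs rsP] : forall l, exists rho : nat -> Q,
  [/\ rho (j l) = p l, rho (j l.+1) = p l.+1,
      forall k, (j l <= k < j l.+1)%N -> rho k.+1 \in ndelta (rho k) (w k) &
      c l -> exists2 k, (j l <= k < j l.+1)%N & rho k \in nacc N].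
  by move=> l; apply/profileP; rewrite je.
(* Consecutive segments agree on the state at their common block boundary. *)
have rsS n : rs (idx n.+1) n.+1 = rs (idx n) n.+1.
  have /andP[ln nl] := idxP n.
  case: (ltnP n.+1 (j (idx n).+1)) => h.
    by rewrite (idxE n.+1 (idx n))// h leqW.
  have e1 : n.+1 = j (idx n).+1 by apply/eqP; rewrite eqn_leq h nl.
  rewrite (idxE n.+1 (idx n).+1); last by rewrite h {1}e1 jS.
  by rewrite e1; have [-> _ _ _] := rsP (idx n).+1; have [_ -> _ _] := rsP (idx n).
exists (fun n => rs (idx n) n); split=> [|n|n].
- rewrite (idxE 0%N 0%N); last by move: (jS 0%N); rewrite j0.
  by have [+ _ _ _] := rsP 0%N; rewrite j0 => ->.
- by rewrite rsS; have [_ _ + _] := rsP (idx n); apply.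
- have [l nl /[dup] cl] := cF n; have [_ _ _ /[apply]-[k jk Fk]] := rsP l.
  exists k; last by rewrite (idxE k l).
  case/andP: jk => jk _; exact: leq_trans nl (leq_trans (blocks_ge jS l) jk).
Qed.

Lemma infinite_pigeonhole (K : finType) (P : nat -> Prop) (c : nat -> K) :
  (forall n, exists2 j, (n <= j)%N & P j) ->
  exists e, forall n, exists2 j, (n <= j)%N & P j /\ c j = e.
Proof.
move=> infP; apply: contrapT => /forallNP H.
have /choice[b bP] : forall e, exists n, forall j, (n <= j)%N -> ~ (P j /\ c j = e).
  move=> e; have /existsNP[n nP] := H e.
  by exists n => j nj Pj; apply: nP; exists j.
have [j bj Pj] := infP (\max_e b e)%N.
by apply: (bP (c j) j) => //; apply: leq_trans bj; exact: leq_bigmax.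
Qed.

(* Positions i and j merge when w[i, k[ and w[j, k[ have the same profile for *)
(* some k, hence for all larger k. There are finitely many merging classes,   *)
(* so one is infinite, and it contains a homogeneous set.                     *)
Lemma exists_homogeneous w :
  exists i e, homogeneous (fun n => w (i + n)%N) e.
Proof.
pose merge i j := exists k,
  [/\ (i <= k)%N, (j <= k)%N & profile w i k = profile w j k].
have [i infi] : exists i, forall n, exists2 j, (n <= j)%N & merge i j.
  apply: contrapT => /forallNP H.
  have /choice[b bP] : forall i, exists n, forall j, (n <= j)%N -> ~ merge i j.
    move=> i; have /existsNP[n nP] := H i.
    by exists n => j nj mj; apply: nP; exists j.
  (* Taking each new position beyond the bounds of the earlier ones yields more pairwise non-merging
     positions than there are profiles; up to a common end [k], two of them would share a
     profile. *)
  have [s [sizes pws]] : exists s : seq nat,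
      size s = #|{: {set Q * Q * bool}}|.+1 /\
      pairwise (fun i j => ~~ `[< merge i j >]) s.
    elim: #|_|.+1 => [|m [s [sm ps]]]; first by exists [::].
    exists (rcons s (\max_(i <- s) b i)%N); rewrite size_rcons sm; split=> //.
    rewrite pairwise_rcons ps andbT; apply/allP => i si; apply/asboolPn.
    by apply: bP; exact: leq_bigmax_seq.
  pose k := (\max_(i <- s) i)%N.
  have : uniq (map (fun i => profile w i k) s).
    rewrite uniq_pairwise pairwise_map; move: pws; apply: sub_in_pairwise (allss s).
    move=> i j si sj /asboolPn nm; apply/negP => /eqP e; apply: nm.
    by exists k; split=> //; exact: (@leq_bigmax_seq _ _ predT id).
  move=> /card_uniqP; rewrite size_map sizes => e.
  have := max_card (mem (map (fun i => profile w i k) s)).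
  by rewrite e ltnn.
have [e eP] := infinite_pigeonhole (profile w i) infi.
exists i, e => n; have [j ij [[k [ik jk ek]] ej]] := eP (i + n)%N.
have ij' : (i <= j)%N by apply: leq_trans ij; exact: leq_addr.
exists (j - i)%N; split; first by rewrite leq_subRL.
  by rewrite profile_shift addn0 subnKC.
exists (k - i)%N; first by rewrite leq_sub2r.
by rewrite !profile_shift addn0 !subnKC.
Qed.

(** The uncountable quantifier over automaton runs becomes a countable combination of conditions on
    finite prefixes. *)
Lemma accepts_fromE T w : accepts_from T w <->
  exists i e, profile_accepts (reach T w i) e /\ homogeneous (fun n => w (i + n)%N) e.
Proof.
split=> [acc|[i [e [pe he]]]]; last first.
  by apply/(accepts_from_reach _ _ i)/(homogeneous_accepts _ he).
have [i [e he]] := exists_homogeneous w; exists i, e; split=> //.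
have [accP _] := homogeneous_accepts (reach T w i) he; apply: accP.
by have [accP _] := accepts_from_reach T w i; exact: accP.
Qed.

End Acceptance.

Section MeasurableQuantifiers.
Context d (T : measurableType d).

Lemma measurable_exists (I : countType) (F : I -> T -> Prop) :
  (forall i, measurable [set t | F i t]) -> measurable [set t | exists i, F i t].
Proof.
move=> mF; rewrite (_ : [set t | _] = \bigcup_i [set t | F i t]).
  by apply: countable_bigcupT_measurable => //; exact: countableP.
by apply/seteqP; split=> t [i]; [exists i|move=> _ Fi; exists i].
Qed.

Lemma measurable_forall (F : nat -> T -> Prop) :
  (forall i, measurable [set t | F i t]) -> measurable [set t | forall i, F i t].
Proof.
move=> mF; rewrite (_ : [set t | _] = \bigcap_i [set t | F i t]).
  exact: bigcapT_measurable.
by apply/seteqP; split=> t Ft i; [move=> _|]; exact: Ft.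
Qed.

Lemma measurable_and (F G : T -> Prop) : measurable [set t | F t] ->
  measurable [set t | G t] -> measurable [set t | F t /\ G t].
Proof. exact: measurableI. Qed.

Lemma measurable_prop (A : Prop) : measurable [set _ : T | A].
Proof.
have [a|a] := pselect A.
  by rewrite (_ : [set _ | _] = setT)//; apply/seteqP; split.
by rewrite (_ : [set _ | _] = set0)//; apply/seteqP; split.
Qed.

End MeasurableQuantifiers.

Lemma measurable_accepts (Sigma : finType) (N : nbw Sigma) (S : finType)
    (lab : S -> Sigma) s (T : {set nstate N}) :
  measurable ([set r | accepts_from T (lab \o r)] : set (path_space s)).
Proof.
have -> : [set r | accepts_from T (lab \o r)] = [set r : path_space s |
    exists i e, profile_accepts (reach T (lab \o r) i) e /\
      forall n, exists j, (n <= j)%N /\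
        (profile N (fun m => lab (r (i + m)%N)) 0 j = e /\ exists k, (j <= k)%N /\
          profile N (fun m => lab (r (i + m)%N)) 0 k =
          profile N (fun m => lab (r (i + m)%N)) j k)].
  apply/seteqP; split=> r /=; rewrite accepts_fromE => -[i [e [pe he]]].
    exists i, e; split=> // n; have [j [nj je [k jk ke]]] := he n.
    by exists j; do !split=> //; exists k.
  exists i, e; split=> // n; have [j [nj [je [k [jk ke]]]]] := he n.
  by exists j; split=> //; exists k.
apply: measurable_exists => i; apply: measurable_exists => e.
apply: measurable_and.
  apply: (@measurable_finitary _ _ i) => r r' rr' /=.
  by rewrite (@eq_reach _ _ _ (lab \o r) (lab \o r'))// => k ki; rewrite /= rr'.
apply: measurable_forall => n; apply: measurable_exists => j.
apply: measurable_and; first exact: measurable_prop.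
have profE (r r' : nat -> S) m k l : (forall n, (n < i + m)%N -> r n = r' n) ->
    (l <= m)%N -> profile N (fun n => lab (r (i + n)%N)) k l =
    profile N (fun n => lab (r' (i + n)%N)) k l.
  move=> rr' lm; apply: eq_profile => t tl.
  by rewrite rr'// ltn_add2l (leq_trans tl).
apply: measurable_and.
  apply: (@measurable_finitary _ _ (i + j)) => r r' rr' /=.
  by rewrite (profE r r' j).
apply: measurable_exists => k; apply: measurable_and; first exact: measurable_prop.
apply: (@measurable_finitary _ _ (i + k)) => r r' rr' /=.
by rewrite !(profE r r' k).
Qed.

(** * The product with the automaton *)

Section ProductMDP.
Variables (R : realType) (Sigma : finType) (N : nbw Sigma).
Local Notation Q := (nstate N).

Lemma big_option (T : finType) (C : pred (option T)) (F : option T -> R) :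
  \sum_(z | C z) F z = (if C None then F None else 0) +
                       \sum_(t | C (Some t)) F (Some t).
Proof.
rewrite big_mkcond (bigD1 None)//=; congr (_ + _).
rewrite (reindex_omap Some id) => [|[]//]; rewrite [RHS]big_mkcond /=.
by apply: eq_bigl => t; rewrite eqxx.
Qed.

Lemma sum_delta (T : finType) (a : T) (F : T -> R) :
  \sum_t (t == a)%:R * F t = F a.
Proof.
by rewrite (bigD1 a)//= eqxx mul1r big1 ?addr0// => t /negbTE ->; rewrite mul0r.
Qed.

(** For transitions whose memory component is a function of the next state, as in the product and in
    the conditioned MDP. *)
Lemma sum_graph (S O : finType) (c : S -> O) (F : S * O -> R) :
  \sum_z (z.2 == c z.1)%:R * F z = \sum_y F (y, c y).
Proof.
transitivity (\sum_y \sum_o (o == c y)%:R * F (y, o)).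
  by rewrite pair_bigA; apply: eq_bigr => -[].
by apply: eq_bigr => y _; rewrite (sum_delta (c y) (fun o => F (y, o))).
Qed.

Definition buchi (S : finType) (x0 : option (S * Q)) : set (path_space x0) :=
  [set r | forall n, exists2 i, (n <= i)%N &
     exists s q, r i = Some (s, q) /\ q \in nacc N].
Arguments buchi {S} x0.

Lemma measurable_buchi (S : finType) (x0 : option (S * Q)) : measurable (buchi x0).
Proof.
apply: measurable_forall => n.
have -> : [set r : path_space x0 | exists2 i, (n <= i)%N &
      exists s q, r i = Some (s, q) /\ q \in nacc N] =
    [set r | exists i, (n <= i)%N /\ exists s q, r i = Some (s, q) /\ q \in nacc N].
  by apply/seteqP; split=> r [i]; [|case]; exists i.
apply: measurable_exists => i; apply: measurable_and; first exact: measurable_prop.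
exact: (measurable_at i [set x | exists s q, x = Some (s, q) /\ q \in nacc N]).
Qed.

Section FixMDP.
Variables (S A : finType) (avail : S -> A -> bool) (P : S -> A -> S -> R).
Variables (lab : S -> Sigma) (s0 : S).
Hypothesis M : is_mdp avail P.

Lemma prod_is_mdp : is_mdp (prod_avail avail lab) (prod_P (N := N) P lab).
Proof.
have [ex av] := M; split.
  case=> [[s q]|] /=; last by have [m _] := ex s0; exists (m, ninit N).
  have [m sm] := ex s; case: (boolP (prod_deadlock lab s q)); first by exists (m, q).
  by move=> /finset.set0Pn[q' q'q]; exists (m, q'); rewrite sm.
move=> [[s q]|] [m q'] /=; last first.
  split=> [[[? ?]|]//|].
  by apply: etrans (big_option predT _) _; rewrite big1 ?addr0.
case: ifP => [_ _|_ /andP[sm _]].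
  split=> [[[? ?]|]//|].
  by apply: etrans (big_option predT _) _; rewrite big1 ?addr0// => -[].
have [P0 P1] := av _ _ sm; split=> [[[t p]|]//|]; first by rewrite mulr_ge0.
apply: etrans (big_option predT _) _; rewrite /= add0r -[RHS]P1.
apply: etrans (sum_graph (fun=> q') (fun z => P s m z.1)).
by apply: eq_bigr => -[].
Qed.

(** Projection to [S] is a simulation. Its potential vanishes on the sink, which accepting runs
    avoid, so nothing has to be matched there. *)
Lemma PSyn_le_PSem : (PSyn N avail P lab s0 <= PSem N avail P lab s0)%E.
Proof.
have [ex av] := M; have [dflt dP] := choice ex.
pose x1 : option (S * Q) := Some (s0, ninit N).
pose f (x : option (S * Q)) := if x is Some (s, _) then s else s0.
(* At a deadlock the product action is unconstrained, so a default action available at [s] replaces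
   it. *)
pose beta (x : option (S * Q)) (b : A * Q) := if x is Some (s, q) then
  if prod_deadlock lab s q then dflt s else b.1 else dflt s0.
pose g (x : option (S * Q)) : R := (x : bool)%:R.
have := @simulation R _ _ _ _ _ _ x1 avail P prod_is_mdp M f beta g.
move=> /(_ _ _ _ (buchi x1) [set r | nbw_accepts N (lab \o r)]).
rewrite mul1e; apply.
- by move=> x; rewrite /g ler0n.
- by move=> [[s q]|] b //=; case: ifP => // _ /andP[].
- move=> [[s q]|] [m q'] y /=.
    rewrite /g big_option /= mulr0 if_same add0r; case: ifP => [_ _|_ /andP[sm _]].
      rewrite big1 ?mulr1; last by move=> []; rewrite mul0r.
      by have [] := av s _ (dP s).
    rewrite mulr1 big_mkcond /=.
    rewrite (eq_bigr (fun z : S * Q => (z.2 == q')%:R *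
      (if z.1 == y then P s m z.1 else 0))).
      rewrite (sum_graph (fun=> q') (fun z => if z.1 == y then P s m z.1 else 0)).
      by rewrite -big_mkcond big_pred1_eq.
    by move=> [t p] _ /=; case: ifP => // _; rewrite ?mulr1 ?mulr0.
  move=> _; rewrite /g mulr0 big_option /= mulr0 if_same add0r.
  by rewrite big1// => z _; rewrite mul0r.
- exact: measurable_buchi.
- rewrite (_ : [set r | _] = [set r | accepts_from [set ninit N]%SET (lab \o r)]).
    exact: measurable_accepts.
  by apply/seteqP; split=> r /nbw_acceptsE.
- move=> r r0 rS rF.
  have rSome n : r n.
    case E : (r n) => [//|]; have rN k : r (n + k)%N = None.
      elim: k => [|k IH]; rewrite ?addn0// addnS.
      have [b _] := rS (n + k)%N; rewrite IH /=.
      by case: (r _) => //; rewrite ltxx.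
    have [i ni [s [q [+ _]]]] := rF n.
    by rewrite -(subnKC ni) rN.
  split; last by move=> n; rewrite /g rSome.
  exists (fun n => if r n is Some (s, q) then q else ninit N); split.
    by rewrite r0.
  split=> [i|n].
    have [[m q'] /=] := rS i; rewrite /f /=.
    have := rSome i; have := rSome i.+1.
    case: (r i) => [[s q]|]//; case: (r i.+1) => [[t p]|]// _ _ /=.
    case: ifP => [|_ /andP[_ q'q]]; first by rewrite ltxx.
    by case: eqP => [->//|]; rewrite mul0r ltxx.
  by have [i ni [s [q [e qF]]]] := rF n; exists i => //; rewrite e.
Qed.

End FixMDP.
End ProductMDP.

Arguments buchi {Sigma N S} x0.

(** * Winning configurations *)

Section ReachWinning.
Variables (R : realType) (Sigma : finType) (N : nbw Sigma).
Local Notation Q := (nstate N).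
Variables (S A : finType) (avail : S -> A -> bool) (P : S -> A -> S -> R).
Variable lab : S -> Sigma.
Hypothesis M : is_mdp avail P.

Definition value s (T : {set Q}) : \bar R :=
  max_prob (x0 := s) avail P [set r | accepts_from T (lab \o r)].

Definition winning s (T : {set Q}) : bool := `[< value s T = 1%E >].

Lemma value_ge0 s T : (0 <= value s T)%E.
Proof. by apply: max_prob_ge0 => //; exact: measurable_accepts. Qed.

Lemma value_le1 s T : (value s T <= 1)%E.
Proof. by apply: max_prob_le1; exact: measurable_accepts. Qed.

Lemma PSem_value s : PSem N avail P lab s = value s [set ninit N]%SET.
Proof.
congr (max_prob _ _ _); apply/seteqP; split=> r /nbw_acceptsE; exact.
Qed.

(** Bellman recursion for reachability with horizon [k]. The default 0 of the maximum is harmless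
    because the candidates are nonnegative. *)
Fixpoint hit k s (T : {set Q}) : R :=
  if winning s T then 1 else
  if k is k'.+1 then \big[Num.max/0]_(m | avail s m)
    \sum_y P s m y * hit k' y (post T (lab s)) else 0.

Lemma hit_winning k s T : winning s T -> hit k s T = 1.
Proof. by case: k => [|k] /= ->. Qed.

Lemma hit_ge0 k s T : 0 <= hit k s T.
Proof.
by case: k => [|k] /=; case: ifP => // _; exact: bigmax_ge_id.
Qed.

Lemma hitS_ge k s T m : avail s m -> ~~ winning s T ->
  \sum_y P s m y * hit k y (post T (lab s)) <= hit k.+1 s T.
Proof. by move=> sm /negbTE /= ->; exact: le_bigmax_cond. Qed.

Lemma hitS_attained k s T : ~~ winning s T -> exists2 m, avail s m &
  \sum_y P s m y * hit k y (post T (lab s)) = hit k.+1 s T.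
Proof.
move=> /negbTE /= ->; have [m sm] := M.1 s.
have [|m' sm' ->] := @eq_bigmax _ _ _ 0 m (avail s)
    (fun m => \sum_y P s m y * hit k y (post T (lab s))) sm.
- move=> m' sm'; apply: sumr_ge0 => y _; rewrite mulr_ge0 ?hit_ge0//.
  by have [] := M.2 _ _ sm'.
- by exists m'.
Qed.

Lemma hit_le1 k s T : hit k s T <= 1.
Proof.
elim: k s T => [|k IH] s T; first by rewrite /=; case: ifP.
have [w|w] := boolP (winning s T); first by rewrite hit_winning.
have [m sm] := hitS_attained k w; rewrite /= (negbTE w) => <-.
have [P0 <-] := M.2 _ _ sm; apply: ler_sum => y _.
by rewrite ler_piMr.
Qed.

Section Runs.
Variables (s0 : S) (T0 : {set Q}).
Variable nu : probability (path_space s0) R.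
Hypothesis flow : forall u x, exists e, is_flow avail P nu u x e.
Hypothesis nu1 : forall x, nu (cyl [:: x]) = ((x == s0)%:R)%:E.

Definition wins_at n (r : path_space s0) : bool :=
  winning (r n) (reach T0 (lab \o r) n).

Let track u : {set Q} := foldl (fun T s => post T (lab s)) T0 u.

Let reach_track u (r : path_space s0) : cyl (x0 := s0) u r ->
  reach T0 (lab \o r) (size u) = track u.
Proof.
elim/last_ind: u => [//|u x IH] /cyl_rcons[ur rx].
by rewrite size_rcons /= IH// /track foldl_rcons rx.
Qed.

Lemma measurable_wins_at n : measurable [set r | wins_at n r].
Proof.
apply: (@measurable_finitary _ _ n.+1) => r r' rr'; rewrite /wins_at /= rr'//.
by rewrite (@eq_reach _ _ _ (lab \o r) (lab \o r'))// => i /ltnW ni; rewrite /= rr'.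
Qed.

Definition wins_between n k : set (path_space s0) :=
  [set r | exists i, (n <= i <= n + k)%N /\ wins_at i r].

Lemma measurable_wins_between n k : measurable (wins_between n k).
Proof.
apply: measurable_exists => i; apply: measurable_and; first exact: measurable_prop.
exact: measurable_wins_at.
Qed.

(** The Bellman inequality summed along the flow: no mixture of available actions beats the best
    one. *)
Lemma wins_between_le k u x :
  (nu (cyl (rcons u x) `&` wins_between (size u) k) <=
   nu (cyl (rcons u x)) * (hit k x (track u))%:E)%E.
Proof.
have mc w n j : measurable ((cyl w : set (path_space s0)) `&` wins_between n j).
  by apply: measurableI; [exact: measurable_cyl|exact: measurable_wins_between].
elim: k u x => [|k IH] u x; have [w|w] := boolP (winning x (track u)).
- rewrite hit_winning// mule1 measureIl//; first exact: measurable_cyl.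
  exact: measurable_wins_between.
- rewrite (_ : _ `&` _ = set0) ?measure0 ?mule_ge0 ?lee_fin ?hit_ge0//.
  apply/seteqP; split=> // r [/cyl_rcons[ur rx] [i [/andP[i1 i2] wi]]].
  have e : i = size u by apply/eqP; rewrite eqn_leq i1 -[size u]addn0 i2.
  by move: wi; rewrite /wins_at e reach_track// rx (negbTE w).
- rewrite hit_winning// mule1 measureIl//; first exact: measurable_cyl.
  exact: measurable_wins_between.
rewrite measure_cyl_split; last exact: measurable_wins_between.
have [e [e0 ea eu eS]] := flow u x.
apply: (@le_trans _ _ (\sum_y nu (cyl (rcons (rcons u x) y)) *
    (hit k y (track (rcons u x)))%:E)%E).
  apply: lee_sum => y _; apply: le_trans (IH (rcons u x) y).
  apply: le_measure; rewrite ?inE//.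
  (* The history is not winning at its own end, so the hit comes later and the window starts one
     step further on. *)
  move=> r [cr [i [/andP[i1 i2] wi]]]; split=> //; exists i; split=> //.
  rewrite size_rcons addSnnS i2 andbT ltn_neqAle i1 andbT.
  apply/negP => /eqP e1; move: wi; case/cyl_rcons: cr => /cyl_rcons[ur rx] _.
  by rewrite /wins_at -e1 reach_track// rx (negbTE w).
rewrite eu; under eq_bigr do rewrite eS -EFinM.
rewrite sumEFin -EFinM lee_fin.
under eq_bigr do rewrite mulr_suml.
rewrite exchange_big mulr_suml /=; apply: ler_sum => b _.
under eq_bigr do rewrite -mulrA; rewrite -mulr_sumr.
have [->|eb] := eqVneq (e b) 0; first by rewrite !mul0r.
rewrite ler_wpM2l// /track foldl_rcons; apply: hitS_ge => //.
by apply: ea; rewrite lt_def eb e0.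
Qed.

Let Acc : set (path_space s0) := [set r | accepts_from T0 (lab \o r)].

Let NW : set (path_space s0) := [set r | forall n, ~~ wins_at n r].

Lemma value_bound : exists2 c : R, 0 <= c < 1 &
  forall s T, ~~ winning s T -> (value s T <= c%:E)%E.
Proof.
pose c := \big[Num.max/0]_(z : S * {set Q} | ~~ winning z.1 z.2) fine (value z.1 z.2).
have valE s T : value s T = (fine (value s T))%:E.
  by rewrite fineK// ge0_fin_numE ?value_ge0// (le_lt_trans (value_le1 s T)) ?ltry.
exists c => [|s T w]; last first.
  rewrite valE lee_fin.
  exact: (le_bigmax_cond _ (fun z => fine (value z.1 z.2)) (j := (s, T))).
rewrite bigmax_ge_id /=; apply: bigmax_lt => // -[s T] /= /asboolPn w.
rewrite -lte_fin -valE lt_neqAle value_le1 andbT; apply/eqP; exact: w.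
Qed.

(* A 0-1 law: given any history that has not met a winning configuration, the *)
(* conditional probability of this event is at most some [c < 1], so it is    *)
(* at most [c] times itself.                                                  *)
Lemma never_winning_null : nu (Acc `&` NW) = 0%E.
Proof.
have [c /andP[c0 c1] cP] := value_bound.
pose A1 := Acc `&` NW; rewrite -/A1.
have mA : measurable A1.
  apply: measurableI; first exact: measurable_accepts.
  apply: measurable_forall => n.
  rewrite (_ : [set r | _] = ~` [set r | wins_at n r]).
    by apply: measurableC; exact: measurable_wins_at.
  by apply/seteqP; split=> r /=; [move/negP|move/negP].
have [mu muE] := measure_image nu mA (@measurable_id _ (path_space s0) setT).
(* [mu] is [nu] restricted to [A1]. A history ending in a winning configuration is disjoint from
   [A1]; after any other, the rest of the run must be accepted from the tracked set, a configuration
   of value at most [c]. *)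
have le_c : (mu A1 <= mscale (NngNum c0) nu A1)%E.
  apply: le_measure_cyl => // u x; rewrite muE /= /mscale /=.
  apply/andP; split; last first.
    rewrite -ge0_fin_numE ?mule_ge0//; apply: fin_numM => //.
    by apply: fin_num_measure; exact: measurable_cyl.
  have [w|w] := boolP (winning x (track u)).
    rewrite (_ : _ `&` _ = set0) ?measure0 ?mule_ge0//.
    apply/seteqP; split=> // r [[_ /(_ (size u)) nw] cr].
    have /cyl_rcons[ur rx] : cyl (x0 := s0) (rcons u x) r by exact: cr.
    by move: nw; rewrite /wins_at reach_track// rx w.
  apply: (@le_trans _ _ (nu (cyl (rcons u x)) * value x (track u))%E); last first.
    by rewrite muleC; apply: lee_wpmul2r => //; exact: cP.
  pose E : set (path_space x) := [set r | accepts_from (track u) (lab \o r)].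
  apply: (@le_trans _ _
      (nu (cyl (rcons u x) `&` path_shift (x0 := s0) x (size u) @^-1` E))%E).
    apply: le_measure; rewrite ?inE.
    - by apply: measurableI => //; exact: measurable_cyl.
    - apply: measurableI; first exact: measurable_cyl.
      rewrite -[X in measurable X]setTI.
      by apply: (measurable_path_shift s0 x (size u)) => //; exact: measurable_accepts.
    - move=> r [[accr _] cr]; split=> //.
      have /cyl_rcons[ur _] : cyl (x0 := s0) (rcons u x) r by exact: cr.
      have [+ _] := accepts_from_reach T0 (lab \o r) (size u).
      by rewrite reach_track// => /(_ accr).
  by apply: conditional_le_max_prob => //; exact: measurable_accepts.
move: le_c; rewrite muE preimage_id setIid /= /mscale /=.
have : nu A1 \is a fin_num by exact: fin_num_measure.
move=> /fineK <-; rewrite -EFinM lee_fin => le_c; congr EFin.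
have : 0 <= fine (nu A1) by rewrite fine_ge0.
rewrite le_eqVlt => /orP[/eqP//|/(ltr_pM2r)] lt_c.
by move: le_c; rewrite leNgt -{2}[fine (nu A1)]mul1r lt_c c1.
Qed.

(** Up to a null set, accepted runs meet a winning configuration; the events of doing so within [k]
    steps increase, and continuity from below passes the bound to their union. *)
Lemma accepts_le_sup_hit (b : \bar R) : (forall k, (hit k s0 T0)%:E <= b)%E ->
  (nu Acc <= b)%E.
Proof.
move=> hb; have mW : measurable Acc by exact: measurable_accepts.
pose F k := wins_between 0 k.
have mF k : measurable (F k) by exact: measurable_wins_between.
have mUF : measurable (\bigcup_k F k) by exact: bigcupT_measurable.
have mN : measurable (Acc `&` NW).
  rewrite (_ : Acc `&` NW = Acc `\` \bigcup_k F k); first exact: measurableD.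
  apply/seteqP; split=> r [Wr]; last first.
    move=> nF; split=> // n; apply/negP => wn; apply: nF.
    by exists n => //; exists n; rewrite leqnn.
  by move=> nw; split=> // -[k _ [i [_]]]; rewrite (negbTE (nw i)).
apply: (@le_trans _ _ (nu (Acc `&` NW) +
                       nu (\bigcup_k F k))%E).
  apply: le_trans (measureU2 _ mN mUF).
  apply: le_measure; rewrite ?inE//; first exact: measurableU.
  move=> r Wr; have [[n wn]|/forallNP nw] := pselect (exists n, wins_at n r).
    by right; exists n => //; exists n; rewrite leqnn.
  by left; split=> // n; apply/negP.
rewrite never_winning_null add0e.
have ndF : nondecreasing_seq F.
  move=> k l kl; apply/subsetPset => r [i [/andP[_ ik] wi]].
  by exists i; rewrite (leq_trans ik).
have cvF : nu \o F @ \oo --> nu (\bigcup_k F k) by exact: nondecreasing_cvg_mu.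
rewrite -(cvg_lim _ cvF)//; apply: lime_le.
  by apply/cvg_ex; eexists; exact: cvF.
apply: nearW => k /=; apply: le_trans (hb k).
have := @measure_cyl_split R S s0 nu (F k) [::] (mF k).
rewrite cyl_nil setTI => ->; rewrite (bigD1 s0)//= big1 => [|x xs].
  rewrite adde0; have := wins_between_le k [::] s0.
  by rewrite /= nu1 eqxx mul1e.
apply/eqP; rewrite eq_le measure_ge0 andbT.
have <- : nu (cyl [:: x]) = 0%E by rewrite nu1 (negbTE xs).
by apply: measureIl => //; exact: measurable_cyl.
Qed.

End Runs.
End ReachWinning.

(** * The conditioned MDP *)

(* In a state (s, Some (T, k)) the transitions are those of the h-transform,  *)
(* with (s, T) the current configuration and k the number of steps left; in a *)
(* state (s, None), entered at the hit, the original MDP is played freely.    *)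
Section Conditioned.
Variables (R : realType) (Sigma : finType) (N : nbw Sigma).
Local Notation Q := (nstate N).
Variables (S A : finType) (avail : S -> A -> bool) (P : S -> A -> S -> R).
Variable lab : S -> Sigma.
Hypothesis M : is_mdp avail P.
Variable n : nat.

Local Notation win := (winning avail P lab).
Local Notation hit := (hit avail P lab).
Local Notation phase := (option ({set Q} * 'I_n.+1)).
Local Notation cstate := (S * phase)%type.

(** Successors with [hit] equal to 0 get weight 0 in the transform; sending them to the free phase
    makes every timed phase entered with [k <= n] active. *)
Definition entry k y (T : {set Q}) : phase :=
  if win y T || (hit k y T == 0) then None else Some (T, inord k).

(** Inactive timed states behave like the free phase, so that the transform is an MDP on the whole
    state type. *)
Definition active s (T : {set Q}) k : bool := ~~ win s T && (0 < hit k s T).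

Definition cnext (x : cstate) y : phase :=
  if x.2 is Some (T, k) then
    if active x.1 T k then entry k.-1 y (post T (lab x.1)) else None
  else None.

Definition cweight (x : cstate) y : R :=
  if x.2 is Some (T, k) then
    if active x.1 T k then hit k.-1 y (post T (lab x.1)) / hit k x.1 T else 1
  else 1.

(** In an active state only actions attaining the maximum in [hit] remain: exactly for them do the
    reweighted probabilities sum to 1. *)
Definition cavail (x : cstate) m : bool :=
  avail x.1 m && if x.2 is Some (T, k) then
    active x.1 T k ==>
      (\sum_y P x.1 m y * hit k.-1 y (post T (lab x.1)) == hit k x.1 T)
  else true.

Definition cP (x : cstate) m (z : cstate) : R :=
  (z.2 == cnext x z.1)%:R * (P x.1 m z.1 * cweight x z.1).

Definition clab (x : cstate) : Sigma := lab x.1.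

Definition cpotential (x : cstate) : R :=
  if x.2 is Some (T, k) then if active x.1 T k then (hit k x.1 T)^-1 else 1 else 1.

Lemma active_gt0 s T k : active s T k -> (0 < k)%N.
Proof. by case: k => // /andP[/negbTE /= ->]; rewrite ltxx. Qed.

Lemma cweight_ge0 x y : 0 <= cweight x y.
Proof.
case: x => s [[T k]|] //; rewrite /cweight /=; case: ifP => // _.
by rewrite divr_ge0 ?hit_ge0.
Qed.

Lemma conditioned_is_mdp : is_mdp cavail cP.
Proof.
split=> [[s [[T k]|]]|x m /andP[sm opt]].
- rewrite /cavail /=; case: (boolP (active s T k)) => [act|_]; last first.
    by have [m sm] := M.1 s; exists m; rewrite sm.
  have [w _] := andP act; have [m sm e] := hitS_attained M k.-1 w.
  by exists m; rewrite sm /= e prednK ?(active_gt0 act)// eqxx.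
- by have [m sm] := M.1 s; exists m; rewrite /cavail sm.
- have [P0 P1] := M.2 _ _ sm; split=> [z|].
    by rewrite mulr_ge0// mulr_ge0// cweight_ge0.
  rewrite (sum_graph (cnext x) (fun z => P x.1 m z.1 * cweight x z.1)) /=.
  case: x sm opt P1 {P0} => s [[T k]|] /= sm opt P1; rewrite /cweight /=; last first.
    by under eq_bigr do rewrite mulr1.
  move: opt; case: (boolP (active s T k)) => [act /eqP opt|_ _]; last first.
    by under eq_bigr do rewrite mulr1.
  under eq_bigr do rewrite mulrA; rewrite -mulr_suml opt divff//.
  by have /andP[_ /gt_eqF ->] := act.
Qed.

Lemma cpotential_ge1 x : 1 <= cpotential x.
Proof.
case: x => s [[T k]|] //; rewrite /cpotential /=; case: ifP => // /andP[_ h0].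
by rewrite invf_ge1// hit_le1.
Qed.

Lemma cpotential_entry k y T : (k <= n)%N -> 0 < hit k y T ->
  cpotential (y, entry k y T) = (hit k y T)^-1.
Proof.
move=> kn h0; rewrite /cpotential /entry /= gt_eqF// orbF.
case: ifPn => [w|w]; first by rewrite hit_winning// invr1.
by rewrite /active inordK// w h0.
Qed.

(** The weights telescope: while a history stays active, its likelihood ratio is [hit] at its end
    over [hit] at its start, and the potential is the reciprocal of [hit]. *)
Lemma cweight_potential x y :
  cweight x y * cpotential (y, cnext x y) <= cpotential x.
Proof.
case: x => s [[T k]|]; rewrite /cweight /cnext {2}/cpotential /= ?mul1r//.
case: ifP => act; last by rewrite mul1r.
have [h0|h0] := ltP 0 (hit k.-1 y (post T (lab s))); last first.
  have -> : hit k.-1 y (post T (lab s)) = 0.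
    by apply/eqP; rewrite eq_le h0 hit_ge0.
  by rewrite !mul0r invr_ge0 hit_ge0.
rewrite cpotential_entry//; last first.
  by apply: leq_trans (leq_pred k) _; rewrite -ltnS ltn_ord.
by rewrite mulrAC divff ?gt_eqF// mul1r.
Qed.

(** Forgetting the phase simulates the conditioned product in the original one, with the same
    actions and with [cpotential] paying for the reweighting. *)
Lemma PSyn_conditioned_le (x0 : cstate) :
  (PSyn N cavail cP clab x0 <= (cpotential x0)%:E * PSyn N avail P lab x0.1)%E.
Proof.
pose f (x : option (cstate * Q)) := if x is Some (z, q) then Some (z.1, q) else None.
pose g (x : option (cstate * Q)) := if x is Some (z, _) then cpotential z else 1.
pose x1 : option (cstate * Q) := Some (x0, ninit N).
have g1 x : 1 <= g x by case: x => [[z q]|] //=; exact: cpotential_ge1.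
have := @simulation R _ _ _ _ _ _ x1 _ _ (prod_is_mdp N clab x0 conditioned_is_mdp)
  (prod_is_mdp N lab x0.1 M) f (fun _ b => b) g.
move=> /(_ _ _ _ (buchi x1) (buchi (f x1))); apply.
- by move=> x; exact: le_trans ler01 (g1 x).
- move=> [[[s o] q]|] [m q'] //=; rewrite /prod_deadlock /clab /=.
  by case: ifP => // _ /andP[/andP[-> _] ->].
- move=> [[[s o] q]|] [m q'] y /=.
    rewrite big_option /= /prod_deadlock /clab /=; case: ifP => [_ _|_].
      rewrite big1 => [|[z p] _]; last by rewrite mul0r.
      rewrite addr0; case: y => [[t p]|] /=; first by rewrite mul0r.
      by rewrite !mul1r cpotential_ge1.
    move=> /andP[/andP[/= sm _] _]; rewrite mul0r if_same add0r.
    case: y => [[t p]|] /=; last by rewrite big_pred0 ?mul0r// => -[].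
    have [P0 _] := M.2 _ _ sm.
    rewrite (bigD1 ((t, cnext (s, o) t), p)) ?eqxx//= big1 => [|[[t' o'] p']].
      rewrite addr0 /cP /= eqxx mul1r -!mulrA !ler_wpM2l//.
      exact: cweight_potential.
    move=> /andP[/eqP[-> ->]] /=; have [->|no _] := eqVneq o' (cnext (s, o) t).
      by rewrite eqxx.
    by rewrite /cP /= (negbTE no) mul0r mulr0 mul0r.
  move=> _; rewrite big_option /= big1 => [|z _]; last by rewrite mul0r.
  by rewrite addr0 !mulr1; case: y.
- exact: measurable_buchi.
- exact: measurable_buchi.
- move=> r _ _ rF; split=> [k|//]; have [i ki [s [q [e qF]]]] := rF k.
  by exists i => //; exists s.1, q; rewrite /= e.
Qed.

(** The free phase is a copy of the original MDP, so the constant potential 1 works. *)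
Lemma value_le_conditioned s (T : {set Q}) :
  (value avail P lab s T <= value cavail cP clab (s, None) T)%E.
Proof.
pose f s : cstate := (s, None).
have := @simulation R _ _ _ _ _ _ s _ _ M conditioned_is_mdp f (fun _ b => b) (fun=> 1).
move=> /(_ _ _ _ [set r | accepts_from T (lab \o r)]
  [set r | accepts_from T (clab \o r)]); rewrite mul1e; apply=> //.
- by move=> x b xb; rewrite /cavail xb.
- move=> x b [t o] xb; rewrite mulr1 /cP /= /cnext /cweight /= mulr1.
  under eq_bigr do rewrite mulr1.
  case: o => [p|]; first by rewrite big_pred0 ?mul0r// => z; apply/eqP.
  by rewrite mul1r (eq_bigl (pred1 t)) ?big_pred1_eq// => z; apply/eqP/eqP => [[]|->].
- exact: measurable_accepts.
- exact: measurable_accepts.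
Qed.

(** Under an optimal action every successor of positive probability has positive [hit], hence value
    1 by induction. The induction ends in a winning configuration, continued in the free phase. *)
Lemma conditioned_value k y (T : {set Q}) : (k <= n)%N -> 0 < hit k y T ->
  (1 <= value cavail cP clab (y, entry k y T) T)%E.
Proof.
elim: k y T => [|k IH] y T kn h0; have [w|w] := boolP (win y T).
- rewrite /entry w /=; apply: le_trans (value_le_conditioned y T).
  by move/asboolP: w => ->.
- by move: h0; rewrite /= (negbTE w) ltxx.
- rewrite /entry w /=; apply: le_trans (value_le_conditioned y T).
  by move/asboolP: w => ->.
have act : active y T (inord k.+1 : 'I_n.+1) by rewrite /active inordK// w.
have [m ym e] := hitS_attained M k w.
rewrite /entry (negbTE w) gt_eqF//=.
apply: (@one_step_max_prob _ _ _ _ _ conditioned_is_mdp _ m _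
   (fun z => [set r | accepts_from (post T (lab y)) (clab \o r)])).
- by rewrite /cavail /= ym act inordK//= e eqxx.
- exact: measurable_accepts.
- by move=> z; exact: measurable_accepts.
- by move=> z r acc; apply/accepts_from_post.
- move=> [z o]; rewrite /cP /cnext /cweight /= act inordK//=.
  case: eqP => [->|]; last by rewrite mul0r ltxx.
  rewrite mul1r => Pz; apply: IH; first exact: ltnW.
  rewrite lt_def hit_ge0// andbT; apply: contraTneq Pz => ->.
  by rewrite mul0r mulr0 ltxx.
Qed.

End Conditioned.

(** * Equivalence of GFM and QGFM *)

Theorem theorem17 (R : realType) (Sigma : finType) (C : nbw Sigma) :
  GFM R C <-> QGFM R C.
Proof.
split=> [gfm S A avail P lab s0 M sem1|qgfm S A avail P lab s0 M].
  by rewrite gfm.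
apply/eqP; rewrite eq_le PSyn_le_PSem//= PSem_value.
pose T0 : {set nstate C} := [set ninit C]%SET.
have hit_le k : ((hit avail P lab k s0 T0)%:E <= PSyn C avail P lab s0)%E.
  have [h0|h0] := ltP 0 (hit avail P lab k s0 T0); last first.
    apply: (@le_trans _ _ 0%E); first by rewrite lee_fin.
    apply: max_prob_ge0; first exact: prod_is_mdp.
    exact: measurable_buchi.
  pose x0 := (s0, entry avail P lab k k s0 T0).
  have Mc := conditioned_is_mdp C lab M k.
  have syn1 : PSyn C (cavail avail P lab (n := k)) (cP avail P lab (n := k))
      (clab lab (n := k)) x0 = 1%E.
    apply: qgfm => //; rewrite PSem_value; apply/eqP; rewrite eq_le.
    by rewrite value_le1 conditioned_value.
  (* The initial potential is the reciprocal of [hit k]; multiplying by [hit k] gives the claim. *)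
  have := PSyn_conditioned_le lab M x0; rewrite syn1 cpotential_entry// => le1.
  rewrite -[leLHS]mule1; apply: (le_trans (lee_wpmul2l _ le1)).
    by rewrite lee_fin ltW.
  by rewrite muleA -EFinM divff ?mul1e// gt_eqF.
apply: ge_ereal_sup => _ [mu [nu [smu numu ->]]].
apply: (@accepts_le_sup_hit _ _ _ _ _ _ _ lab M s0 T0 nu) => //.
- exact: strategy_flow numu.
- by move=> x; rewrite numu /= mulr1.
Qed.
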